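(* Let $(X,d)$ be a complete metric space that supports a doubling Borel measure $\mu$ which is non-trivial and finite on balls. If $X$ supports a weak $p$-Poincaré inequality for some $1\leq p<\infty$, then $\mathrm{LIP}^{\infty}(X)=M^{1,\infty}(X)=N^{1,\infty}(X)$ with equivalent norms.
   Context: $(X,d,\mu)$ is a metric measure space with $\mu$ Borel regular: $\mu$ is an outer measure for which Borel sets are measurable and every $A\subset X$ is contained in a Borel set $B$ with $\mu(A)=\mu(B)$. $\|\cdot\|_{L^\infty}$ is the $\mu$-essential supremum norm. Curves: for a continuous curve $\gamma:[a,b]\to X$, $\ell(\gamma)=\sup\sum_i d(\gamma(t_i),\gamma(t_{i+1}))$ over partitions of $[a,b]$; $\gamma$ is rectifiable if $\ell(\gamma)<\infty$. For Borel $g\ge 0$, $\int_\gamma g$ is the line integral with respect to arc length. $\Upsilon$ is the family of nonconstant rectifiable curves in $X$. Upper gradients: a Borel function $g:X\to[0,\infty]$ is an upper gradient of an extended real-valued function $f$ on $X$ if $|f(\gamma(a))-f(\gamma(b))|\le\int_\gamma g$ for every rectifiable curve $\gamma:[a,b]\to X$ (the left side being $+\infty$ if $f(\gamma(a))$ or $f(\gamma(b))$ is infinite). For $\Gamma\subset\Upsilon$, $\mathrm{Mod}_\infty(\Gamma)=\inf\|\rho\|_{L^\infty}$ over all Borel $\rho:X\to[0,\infty]$ with $\int_\gamma\rho\ge1$ for all $\gamma\in\Gamma$. A property holds for $\infty$-a.e. curve if it holds for all $\gamma\in\Upsilon\setminus\Gamma$ for some $\Gamma$ with $\mathrm{Mod}_\infty(\Gamma)=0$.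 A Borel $g\ge0$ is an $\infty$-weak upper gradient of $f$ if $|f(\gamma(a))-f(\gamma(b))|\le\int_\gamma g$ holds for $\infty$-a.e. curve $\gamma:[a,b]\to X$ in $\Upsilon$ (with the same convention that the left side is $+\infty$ if $f(\gamma(a))$ or $f(\gamma(b))$ is infinite). Spaces: $\mathrm{LIP}^\infty(X)$ is the space of bounded Lipschitz functions $f:X\to\mathbb{R}$, with norm $\|f\|_\infty+\mathrm{LIP}(f)$, where $\|f\|_\infty$ is the supremum norm and $\mathrm{LIP}(f)$ is the Lipschitz constant. $M^{1,\infty}(X)$ is the space (modulo equality $\mu$-a.e.) of $f\in L^\infty(X)$ for which there is $0\le g\in L^\infty(X)$ with $|f(x)-f(y)|\le d(x,y)(g(x)+g(y))$ $\mu$-a.e. (i.e. for all $x,y$ outside a $\mu$-null set), with norm $\|f\|_{L^\infty}+\inf_g\|g\|_{L^\infty}$ over all such $g$. $\widetilde N^{1,\infty}(X)$ is the class of Borel functions $f\in L^\infty(X)$ having an $\infty$-weak upper gradient in $L^\infty$, with $\|f\|_{\widetilde N^{1,\infty}}=\|f\|_{L^\infty}+\inf_g\|g\|_{L^\infty}$ over all $\infty$-weak upper gradients $g$ of $f$; $N^{1,\infty}(X)$ is the quotient of $\widetilde N^{1,\infty}(X)$ by $u\sim v\iff\|u-v\|_{\widetilde N^{1,\infty}}=0$, with the induced norm. The spaces are compared via $f\mapsto[f]$, sending a bounded Lipschitz function to its equivalence class. Doubling: there is $C_\mu>0$ with $0<\mu(B(x,2r))\le C_\mu\,\mu(B(x,r))<\infty$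 for all $x\in X$, $r>0$ ($B(x,r)$ the open ball). Weak $p$-Poincaré inequality: there exist $C_p>0$ and $\lambda\ge1$ such that for every Borel measurable $u:X\to\mathbb{R}$, every upper gradient $g:X\to[0,\infty]$ of $u$, and every ball $B(x,r)\subset X$, $\frac{1}{\mu(B(x,r))}\int_{B(x,r)}|u-u_{B(x,r)}|\,d\mu\le C_p\,r\Big(\frac{1}{\mu(B(x,\lambda r))}\int_{B(x,\lambda r)}g^p\,d\mu\Big)^{1/p}$, where $u_{B}=\frac1{\mu(B)}\int_B u\,d\mu$. *)

(* Defs.v *)
From HB Require Import structures.
From mathcomp Require Import all_boot all_order all_algebra.
From mathcomp Require Import all_classical all_reals all_analysis.
From mathcomp Require Import measurable_realfun ess_sup_inf.

Set Implicit Arguments.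
Unset Strict Implicit.
Unset Printing Implicit Defensive.

Import Order.TTheory GRing.Theory Num.Theory.
Import numFieldNormedType.Exports.

Local Open Scope classical_set_scope.
Local Open Scope ring_scope.
Local Open Scope ereal_scope.

(* Completeness is that of the uniform structure: every Cauchy filter
   converges.  Complete types are pointed, which is harmless here since a space
   carrying a nonzero measure is nonempty. *)
#[short(type="completeMetricType")]
HB.structure Definition CompleteMetric (R : numDomainType) :=
  { T of Complete T & Metric R T }.

Section curves.
Context (R : realType) (X : metricType R).

(* A curve on [a, b]; the values of cfun outside [a, b] are junk, and no notion
   below depends on them. *)
Record curve := Curve {
  cstart : R;
  cend : R;
  cfun :> R -> X;
  cstart_le_cend : (cstart <= cend)%R;
  curve_continuous : {within `[cstart, cend], continuous cfun} }.

(* [itv_partition a b s] says that a :: s is strictly increasing and ends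
   at b. *)
Definition path_length (a b : R) (f : R -> X) : \bar R :=
  ereal_sup [set (\sum_(0 <= i < size s)
    mdist (f (nth b (a :: s) i)) (f (nth b (a :: s) i.+1)))%:E
    | s in itv_partition a b].

Definition curve_length (c : curve) : \bar R :=
  path_length (cstart c) (cend c) c.

Definition rectifiable (c : curve) : Prop := curve_length c < +oo.

Definition nonconstant (c : curve) : Prop :=
  exists s t, [/\ s \in `[cstart c, cend c], t \in `[cstart c, cend c]
                & c s <> c t].

Definition Upsilon : set curve :=
  [set c | rectifiable c /\ nonconstant c].

(* Arc-length parametrization on [0, l(c)]: the point reached at the first
   parameter t such that c restricted to [a, t] has length u. *)
Definition arclength_param (c : curve) (u : R) : X :=
  c (inf [set t : R | t \in `[cstart c, cend c] /\
                      path_length (cstart c) t c = u%:E]).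

Definition line_integral (c : curve) (g : X -> \bar R) : \bar R :=
  \int[lebesgue_measure]_(u in `[0%R, fine (curve_length c)])
    g (arclength_param c u).

(* On infinite values, the conventions of \bar R give |f a - f b| = +oo as soon
   as f a or f b is infinite (including when +oo - +oo or -oo - -oo arises). *)
Definition ug_inequality (f g : X -> \bar R) (c : curve) : Prop :=
  `| f (c (cstart c)) - f (c (cend c)) | <= line_integral c g.

End curves.

Section borel.
Context (R : realType) (X : completeMetricType R).

Definition borel_set (A : set X) : Prop := <<s @open X >> A.

Definition borel_fun (d : measure_display) (Y : measurableType d)
    (f : X -> Y) : Prop :=
  measurable_fun [set: g_sigma_algebraType (@open X)] f.

Definition upper_gradient (f g : X -> \bar R) : Prop :=
  [/\ borel_fun g, (forall x, 0 <= g x) &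
      forall c : curve X, rectifiable c -> ug_inequality f g c].

End borel.

Section lipschitz_space.
Context (R : realType) (X : metricType R).

Definition is_lipschitz_constant (f : X -> R) (L : R) : Prop :=
  (0 <= L)%R /\ forall x y, (`|f x - f y| <= L * mdist x y)%R.

Definition LIPoo : set (X -> R) :=
  [set f | (exists M, forall x, (`|f x| <= M)%R) /\
           (exists L, is_lipschitz_constant f L)].

Definition LIPoo_norm (f : X -> R) : \bar R :=
  (sup (range (fun x => `|f x|)) + inf (is_lipschitz_constant f))%:E.

End lipschitz_space.

Section metric_measure_space.
Context (R : realType) (X : completeMetricType R).
Variable mu : {outer_measure set X -> \bar R}.

Definition borel_regular : Prop :=
  (forall B, borel_set B -> mu.-caratheodory B) /\
  (forall A, exists B, [/\ borel_set B, A `<=` B & mu A = mu B]).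

Definition doubling : Prop :=
  exists2 C : R, (0 < C)%R & forall (x : X) (r : R), (0 < r)%R ->
    [/\ 0 < mu (ball x (2 * r)%R),
        mu (ball x (2 * r)%R) <= C%:E * mu (ball x r) &
        C%:E * mu (ball x r) < +oo].

(* mu as a (complete) measure on its Caratheodory sigma-algebra; integrals,
   essential suprema and "almost everywhere" refer to it. *)
Definition cmeas : {measure set (caratheodory_type mu) -> \bar R} :=
  (mu : set (caratheodory_type mu) -> \bar R).

Definition Linfty_norm (f : X -> \bar R) : \bar R := 'N[cmeas]_+oo[f].

Definition Linfty (f : X -> \bar R) : Prop :=
  measurable_fun [set: caratheodory_type mu] f /\ Linfty_norm f < +oo.

Definition average (B : set X) (f : X -> \bar R) : \bar R :=
  (\int[cmeas]_(x in B) f x) / mu B.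

(* u is not assumed integrable on the ball.  When it is not, the average of u
   is infinite or, for oo - oo, -oo, so the left-hand side is +oo. *)
Definition weak_poincare (p : R) : Prop :=
  exists C lambda : R, [/\ (0 < C)%R, (1 <= lambda)%R &
    forall (u : X -> R) (g : X -> \bar R), borel_fun u ->
      upper_gradient (EFin \o u) g ->
      forall (x : X) (r : R), (0 < r)%R ->
        average (ball x r)
          (fun y => `| (u y)%:E - average (ball x r) (EFin \o u) |)
        <= (C * r)%:E *
           average (ball x (lambda * r)%R) (fun y => g y `^ p) `^ p^-1].

Definition Mod_oo (Gamma : set (curve X)) : \bar R :=
  ereal_inf [set Linfty_norm rho | rho in
    [set rho : X -> \bar R | [/\ borel_fun rho, (forall x, 0 <= rho x) &
      forall c, Gamma c -> 1 <= line_integral c rho]]].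

Definition ae_curve (P : curve X -> Prop) : Prop :=
  exists Gamma : set (curve X), [/\ Gamma `<=` @Upsilon R X, Mod_oo Gamma = 0 &
    forall c, (@Upsilon R X `\` Gamma) c -> P c].

Definition weak_upper_gradient (f g : X -> \bar R) : Prop :=
  [/\ borel_fun g, (forall x, 0 <= g x) & ae_curve (ug_inequality f g)].

Definition Ntilde : set (X -> \bar R) :=
  [set f | [/\ borel_fun f, Linfty f &
    exists2 g, weak_upper_gradient f g & Linfty g]].

Definition Ntilde_norm (f : X -> \bar R) : \bar R :=
  Linfty_norm f +
  ereal_inf [set Linfty_norm g | g in weak_upper_gradient f].

(* Elements of the quotient spaces are equivalence classes, i.e. sets of
   functions.  The norm is constant on each class, so the infimum over the class
   is the norm of any representative. *)
Definition Nclass (f : X -> \bar R) : set (X -> \bar R) :=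
  [set h | Ntilde h /\ Ntilde_norm (f \- h) = 0].

Definition N1oo : set (set (X -> \bar R)) := Nclass @` Ntilde.

Definition N1oo_norm (F : set (X -> \bar R)) : \bar R :=
  ereal_inf (Ntilde_norm @` F).

Definition hajlasz_gradient (f g : X -> R) : Prop :=
  [/\ Linfty (EFin \o g), (forall x, (0 <= g x)%R) &
      exists2 E : set X, mu E = 0 & forall x y, ~ E x -> ~ E y ->
        (`|f x - f y| <= mdist x y * (g x + g y))%R].

Definition Mtilde : set (X -> R) :=
  [set f | Linfty (EFin \o f) /\ exists g, hajlasz_gradient f g].

Definition Mtilde_norm (f : X -> R) : \bar R :=
  Linfty_norm (EFin \o f) +
  ereal_inf [set Linfty_norm (EFin \o g) | g in hajlasz_gradient f].

Definition Mclass (f : X -> R) : set (X -> R) :=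
  [set h | Mtilde h /\ f = h %[ae cmeas]].

Definition M1oo : set (set (X -> R)) := Mclass @` Mtilde.

Definition M1oo_norm (F : set (X -> R)) : \bar R :=
  ereal_inf (Mtilde_norm @` F).

End metric_measure_space.

(* Main.v *)
Require Import Defs.
From mathcomp Require Import all_boot all_order all_algebra.
From mathcomp Require Import all_classical all_reals all_analysis.
From mathcomp Require Import measurable_realfun ess_sup_inf.
From mathcomp Require Import lra.

Set Implicit Arguments.
Unset Strict Implicit.
Unset Printing Implicit Defensive.

Import Order.TTheory GRing.Theory Num.Theory.
Import numFieldNormedType.Exports.

Local Open Scope classical_set_scope.
Local Open Scope ring_scope.
Local Open Scope ereal_scope.

(** A bounded Lipschitz function belongs to both other spaces, with its Lipschitz
    constant as a gradient.  Balls have positive measure, so a null set has a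
    dense complement: Lipschitz functions that agree almost everywhere are equal,
    and a Lipschitz bound valid outside a null set extends to the whole space.
    This gives injectivity and the upper bounds for the norms, and it settles the
    Hajlasz space: a Hajlasz gradient with essential bound G makes the function
    2G-Lipschitz outside a null set, and the McShane extension of the restriction
    is the required representative.

    For the Newtonian space, let f have a weak upper gradient with essential
    bound G.  There is a Borel null set N such that the upper gradient inequality
    holds with the constant G along every curve that meets N in zero length
    ([weak_upper_gradient_lipschitz]): N contains the points where the gradient
    exceeds G and those where functions admissible for the exceptional family
    exceed their arbitrarily small essential bounds, so that an exceptional curve
    cannot meet N in zero length.  Hence the function equal to oo on N and to G
    elsewhere is a genuine upper gradient of a truncation u of f, and the Poincare
    inequality bounds the mean oscillation of u on a ball of radius r by a multiple
    of G r.  In a doubling space this forces u to agree almost everywhere with a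
    Lipschitz function h, with constant a multiple of G ([ae_lipschitz]): the means
    of u over the balls centred at x converge at a linear rate to h x, and
    |u - h| has integral at most a constant times r times the measure on every
    ball of radius r.  A finite maximal separated net at scale e, whose half-balls
    are disjoint, then bounds the integral of |u - h| over a fixed ball by a
    multiple of e ([ae0_of_ball_integrals]).

    It remains to see that f and h have the same class, although the Newtonian
    equivalence looks finer than equality almost everywhere.  It is not
    ([NclassP]): if two Newtonian functions agree outside a null set, then along
    a curve meeting a suitable null set N in zero length they agree at points
    arbitrarily close to the endpoints, and both are Lipschitz along the curve, so
    they agree at the endpoints too.  So the function oo on N and 0 elsewhere, of
    essential norm 0, is a weak upper gradient of their difference.  The analysis
    along curves rests on the continuity of the arc length and on the compatibility
    of the arc-length parametrization with subcurves. *)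

(** * Length of paths *)

Section path_length.
Context (R : realType) (X : metricType R).
Implicit Types (f : R -> X) (a b c x : R) (s : seq R).

(** The recursion follows the partition from left to right and needs no default
    value, which makes concatenation and induction on the partition direct. *)
Fixpoint polygon_length f a s : R :=
  if s is x :: s' then (mdist (f a) (f x) + polygon_length f x s')%R else 0%R.

Lemma polygon_lengthE f a s :
  (\sum_(0 <= i < size s)
    mdist (f (nth a (a :: s) i)) (f (nth a (a :: s) i.+1)))%R =
  polygon_length f a s.
Proof.
suff H d : (\sum_(0 <= i < size s)
    mdist (f (nth d (a :: s) i)) (f (nth d (a :: s) i.+1)))%R =
    polygon_length f a s by exact: H.
elim: s a => [|x s IH] a /=; first by rewrite big_nil.
by rewrite big_nat_recl//= -IH.
Qed.

Lemma path_lengthE f a b : path_length a b f =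
  ereal_sup [set (polygon_length f a s)%:E | s in itv_partition a b].
Proof.
congr ereal_sup; apply/seteqP; split=> _ /= [s sab <-]; exists s => //;
  rewrite -polygon_lengthE; congr EFin; apply: eq_big_nat => i /andP[_ ilt];
  by congr (mdist (f _) (f _)); apply: set_nth_default => //=; exact: ltnW.
Qed.

Lemma itv_partition_consP a b x s :
  itv_partition a b (x :: s) <-> (a < x)%R /\ itv_partition x b s.
Proof.
by rewrite /itv_partition/=; split=> [[/andP[-> ->] ->]|[-> [-> ->]]].
Qed.

Lemma itv_partition_le a b s : itv_partition a b s -> (a <= b)%R.
Proof.
elim: s a => [|x s IH] a; first by move=> [_ /eqP/= ->].
by move=> /itv_partition_consP[/ltW ax /IH]; exact: le_trans.
Qed.

Lemma polygon_length_ge0 f a s : (0 <= polygon_length f a s)%R.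
Proof. by elim: s a => //= x s IH a; rewrite addr_ge0// mdist_ge0. Qed.

Lemma polygon_le_path_length f a b s : itv_partition a b s ->
  (polygon_length f a s)%:E <= path_length a b f.
Proof. by move=> sab; rewrite path_lengthE; apply: ereal_sup_ubound; exists s. Qed.

Lemma mdist_le_path_length f a b : (a <= b)%R ->
  (mdist (f a) (f b))%:E <= path_length a b f.
Proof.
rewrite le_eqVlt => /predU1P[->|ab].
  by rewrite mdistxx; apply: (@polygon_le_path_length f b b [::]); split.
apply: le_trans (@polygon_le_path_length f a b [:: b] _); last exact: itv_partition1.
by rewrite /= addr0.
Qed.

Lemma path_length_ge0 f a b : (a <= b)%R -> 0 <= path_length a b f.
Proof.
by move=> /(mdist_le_path_length f); apply: le_trans; rewrite lee_fin mdist_ge0.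
Qed.

Lemma path_lengthxx f a : path_length a a f = 0.
Proof.
apply/eqP; rewrite eq_le path_length_ge0// andbT path_lengthE.
apply: ge_ereal_sup => _ [[|x s] xs <-]//=.
by move/itv_partition_consP: xs => [ax /itv_partition_le]; rewrite leNgt ax.
Qed.

Lemma polygon_length_cat f a s1 s2 : polygon_length f a (s1 ++ s2) =
  (polygon_length f a s1 + polygon_length f (last a s1) s2)%R.
Proof. by elim: s1 a => /= [|x s IH] a; rewrite ?add0r// IH addrA. Qed.

(** Inserting [c] in a partition of [a, b] does not shorten the polygon, and
    partitions of the two halves concatenate. *)
Lemma path_lengthD f a c b : (a <= c)%R -> (c <= b)%R ->
  path_length a b f = path_length a c f + path_length c b f.
Proof.
have cat_le s1 s2 x y z : itv_partition x y s1 -> itv_partition y z s2 ->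
    (polygon_length f x s1)%:E + (polygon_length f y s2)%:E
    <= path_length x z f.
  move=> p1 p2; apply: (@le_trans _ _ (polygon_length f x (s1 ++ s2))%:E).
    by rewrite polygon_length_cat EFinD; case: p1 => _ /eqP ->.
  by apply: polygon_le_path_length; exact: itv_partition_cat p1 p2.
have cat_sup s1 x y z : (y <= z)%R -> itv_partition x y s1 ->
    (polygon_length f x s1)%:E + path_length y z f <= path_length x z f.
  move=> yz p1; rewrite addeC -leeBrDr//.
  rewrite [leLHS]path_lengthE; apply: ge_ereal_sup => _ [s2 p2 <-].
  by rewrite leeBrDr// addeC; exact: cat_le p1 p2.
move=> ac cb; apply/eqP; rewrite eq_le; apply/andP; split.
  rewrite [leLHS]path_lengthE; apply: ge_ereal_sup => _ [s p <-].
  elim: s a ac p => [|x s IH] a ac p.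
    by rewrite adde_ge0// path_length_ge0.
  have [ax xs] := (itv_partition_consP _ _ _ _).1 p.
  have [xc|cx] := leP x c.
    rewrite /= EFinD; apply: (le_trans (leeD2l _ (IH _ xc xs))).
    rewrite addeA leeD2r//; have := cat_sup [:: x] a x c xc.
    by rewrite /= addr0; apply; exact: itv_partition1.
  rewrite /=; apply: (@le_trans _ _ ((mdist (f a) (f c))%:E +
      (polygon_length f c (x :: s))%:E)).
    by rewrite /= -EFinD lee_fin addrA lerD2r metric_triangle.
  apply: leeD; first exact: mdist_le_path_length.
  by apply: polygon_le_path_length; apply/itv_partition_consP.
have [->|nfin] := eqVneq (path_length a b f) +oo; first by rewrite leey.
have cbfin : path_length c b f \is a fin_num.
  rewrite ge0_fin_numE ?path_length_ge0// ltey; apply: contra_neq nfin => cboo.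
  apply/eqP; rewrite -leye_eq -cboo.
  have [->|ac'] := eqVneq a c; first by [].
  have p1 : itv_partition a c [:: c] by apply: itv_partition1; rewrite lt_neqAle ac'.
  apply: le_trans (cat_sup _ _ _ _ cb p1); rewrite leeDr//.
  by rewrite lee_fin polygon_length_ge0.
rewrite -leeBrDr// [leLHS]path_lengthE; apply: ge_ereal_sup => _ [s p <-].
by rewrite leeBrDr//; exact: cat_sup p.
Qed.

Lemma eq_path_length f g a b : (forall x, (a <= x <= b)%R -> f x = g x) ->
  path_length a b f = path_length a b g.
Proof.
move=> fg; rewrite !path_lengthE; congr ereal_sup; apply: eq_imagel => s sab.
congr EFin; elim: s a fg sab => [//|x s IH] a fg p.
have [ax /[dup] xs /itv_partition_le xb] := (itv_partition_consP _ _ _ _).1 p.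
rewrite /= !fg ?(ltW ax) ?lexx//= ?(le_trans (ltW ax) xb)// IH// => y /andP[xy yb].
by rewrite fg// yb (le_trans (ltW ax)).
Qed.

End path_length.

(** * Arc length along a rectifiable curve *)

Section arc_length.
Context (R : realType) (X : metricType R).
Variable c : curve X.
Hypothesis rc : rectifiable c.
Let a := cstart c.
Let b := cend c.
Implicit Types s t u : R.

Definition arc_length t : R := fine (path_length (cstart c) t c).
Local Notation v := arc_length.

Let ab : (a <= b)%R := cstart_le_cend c.

Lemma sub_path_length_fin_num s t : (a <= s)%R -> (s <= t)%R -> (t <= b)%R ->
  path_length s t c \is a fin_num.
Proof.
move=> as_ st tb; rewrite ge0_fin_numE ?path_length_ge0//.
apply: le_lt_trans rc; rewrite /curve_length.
rewrite (path_lengthD _ as_ (le_trans st tb)) (path_lengthD _ st tb).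
rewrite addeCA; apply: leeDl.
by rewrite adde_ge0// path_length_ge0//.
Qed.

Lemma arc_lengthE t : (a <= t <= b)%R -> path_length a t c = (v t)%:E.
Proof. by move=> /andP[at_ tb]; rewrite fineK// sub_path_length_fin_num. Qed.

Lemma arc_lengthB s t : (a <= s)%R -> (s <= t)%R -> (t <= b)%R ->
  path_length s t c = (v t - v s)%:E.
Proof.
move=> as_ st tb; have := path_lengthD c as_ st.
rewrite -(fineK (sub_path_length_fin_num as_ st tb)).
rewrite !arc_lengthE ?as_ ?(le_trans st)//= ?tb ?(le_trans as_ st)// => -[->].
by congr EFin; rewrite addrAC subrr add0r.
Qed.

Lemma arc_length_start : v a = 0%R.
Proof. by rewrite /v path_lengthxx. Qed.

Lemma arc_length_le s t : (a <= s)%R -> (s <= t)%R -> (t <= b)%R -> (v s <= v t)%R.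
Proof.
move=> as_ st tb; rewrite -subr_ge0 -lee_fin -arc_lengthB//.
exact: path_length_ge0.
Qed.

Lemma arc_length_itv t : (a <= t <= b)%R -> (0 <= v t <= v b)%R.
Proof.
by move=> /andP[at_ tb]; rewrite -arc_length_start !arc_length_le.
Qed.

Lemma mdist_le_arc_length s t : (a <= s <= b)%R -> (a <= t <= b)%R ->
  (mdist (c s) (c t) <= `|v s - v t|)%R.
Proof.
wlog st : s t / (s <= t)%R.
  move=> H; have [|/ltW ts] := leP s t; first exact: H.
  by move=> sab tab; rewrite distrC metric_sym; exact: H.
move=> /andP[as_ _] /andP[_ tb].
rewrite distrC; apply: le_trans (ler_norm _).
by rewrite -lee_fin -arc_lengthB// mdist_le_path_length.
Qed.

Lemma curve_modulus t (e : R) : (a <= t <= b)%R -> (0 < e)%R ->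
  exists2 d : R, (0 < d)%R &
    forall s, (a <= s <= b)%R -> (`|t - s| < d)%R -> (mdist (c t) (c s) < e)%R.
Proof.
move=> tab e0; have /subspace_continuousP/(_ t) := @curve_continuous _ _ c.
have tI : `[cstart c, cend c]%classic t by rewrite /= in_itv.
move=> /(_ tI)/metricType_numDomainType.cvgrPdist_lt/(_ e e0); rewrite near_withinE => /nbhs_ballP[d d0 H].
by exists d => // s sab tsd; apply: (H s) => //=; rewrite in_itv.
Qed.

(** Take a polygon on [t, b] that almost realizes the length.  Replacing its first
    vertex by a later parameter [s] loses at most the chord from [t] to [s], which
    is small; so the length from [s] to [b] is almost that from [t] to [b]. *)
Lemma arc_length_right t (e : R) : (a <= t)%R -> (t < b)%R -> (0 < e)%R ->
  exists2 d : R, (0 < d)%R &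
    forall s, (t <= s <= b)%R -> (s - t < d)%R -> (v s - v t < e)%R.
Proof.
move=> at_ tb e0; have e20 : (0 < e / 2)%R by rewrite divr_gt0.
have Lfin := sub_path_length_fin_num at_ (ltW tb) (lexx b).
have [_ [[|x p] pt <-]] := ub_ereal_sup_adherent e20
    (eq_ind _ (fun z => is_true (z \is a fin_num)) Lfin _ (path_lengthE _ _ _)).
  by case: pt => _ /eqP/= tb'; rewrite tb' ltxx in tb.
have [tx xp] := (itv_partition_consP _ _ _ _).1 pt.
rewrite -path_lengthE (arc_lengthB at_ (ltW tb) (lexx b)) -EFinB lte_fin /= => Hp.
have tab : (a <= t <= b)%R by rewrite at_ ltW.
have [d d0 Hd] := curve_modulus tab e20.
exists (Num.min d (x - t))%R; first by rewrite lt_min d0 subr_gt0.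
move=> s /andP[ts sb]; rewrite lt_min => /andP[std]; rewrite ltrBDr subrK => sx.
have sab : (a <= s <= b)%R by rewrite sb (le_trans at_).
have dts : (mdist (c t) (c s) < e / 2)%R by apply: Hd => //; rewrite distrC ger0_norm// subr_ge0.
have := polygon_le_path_length c ((itv_partition_consP _ _ _ _).2 (conj sx xp)).
rewrite arc_lengthB//; last by rewrite (le_trans at_).
rewrite lee_fin /=; have := metric_triangle (c t) (c s) (c x).
by move=> tri Hs; lra.
Qed.

(** The mirror image of [arc_length_right]: here the last vertex of the polygon
    moves. *)
Lemma arc_length_left t (e : R) : (a < t)%R -> (t <= b)%R -> (0 < e)%R ->
  exists2 d : R, (0 < d)%R &
    forall s, (a <= s <= t)%R -> (t - s < d)%R -> (v t - v s < e)%R.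
Proof.
move=> at_ tb e0; have e20 : (0 < e / 2)%R by rewrite divr_gt0.
have Lfin := sub_path_length_fin_num (lexx a) (ltW at_) tb.
have [_ [p pt <-]] := ub_ereal_sup_adherent e20
    (eq_ind _ (fun z => is_true (z \is a fin_num)) Lfin _ (path_lengthE _ _ _)).
rewrite -path_lengthE arc_lengthE ?tb ?ltW// -EFinB lte_fin.
case/lastP: p pt => [|p y].
  by case=> _ /eqP/= tb'; rewrite tb' ltxx in at_.
rewrite /itv_partition rcons_path last_rcons => -[/andP[ap py] /eqP yt].
subst y; rewrite -cats1 polygon_length_cat /= addr0 => Hp.
set x := last a p in py Hp *.
have tab : (a <= t <= b)%R by rewrite tb ltW.
have [d d0 Hd] := curve_modulus tab e20.
exists (Num.min d (t - x))%R; first by rewrite lt_min d0 subr_gt0.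
move=> s /andP[as_ st]; rewrite lt_min => /andP[std]; rewrite ltrD2l ltrN2 => xs.
have sab : (a <= s <= b)%R by rewrite as_ (le_trans st).
have dts : (mdist (c t) (c s) < e / 2)%R by apply: Hd => //; rewrite ger0_norm// subr_ge0.
have ps : itv_partition a s (p ++ [:: s]).
  by split; rewrite ?cat_path ?last_cat//= ap/= xs.
have := polygon_le_path_length c ps.
rewrite arc_lengthE// lee_fin polygon_length_cat /= addr0 -/x.
have := metric_triangle (c x) (c s) (c t); rewrite (metric_sym (c s)).
by move=> tri Hs; lra.
Qed.

Lemma arc_length_continuous : {within `[a, b], continuous v}.
Proof.
apply/subspace_continuousP => t /=; rewrite in_itv/= => /andP[at_ tb].
apply/cvgrPdist_lt => e e0; rewrite near_withinE; apply/nbhs_ballP.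
have [d1 d10 H1] : exists2 d : R, (0 < d)%R &
    forall s, (t <= s <= b)%R -> (s - t < d)%R -> (v s - v t < e)%R.
  have [tb'|bt] := ltP t b; first exact: arc_length_right.
  exists 1%R => // s /andP[ts sb] _.
  by rewrite (le_anti (introT andP (conj ts (le_trans sb bt)))) subrr.
have [d2 d20 H2] : exists2 d : R, (0 < d)%R &
    forall s, (a <= s <= t)%R -> (t - s < d)%R -> (v t - v s < e)%R.
  have [at'|ta] := ltP a t; first exact: arc_length_left.
  exists 1%R => // s /andP[as_ st] _.
  by rewrite (le_anti (introT andP (conj st (le_trans ta as_)))) subrr.
exists (Num.min d1 d2); first by rewrite /= lt_min d10.
move=> s; rewrite /= /ball/= lt_min => /andP[ts1 ts2]; rewrite in_itv/= => /andP[as_ sb].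
have [st|ts] := leP s t.
  rewrite ger0_norm ?subr_ge0 ?arc_length_le//; apply: H2; first by rewrite as_.
  by apply: le_lt_trans ts2; rewrite ler_norm.
have vts : (v t <= v s)%R by apply: arc_length_le => //; exact: ltW.
rewrite distrC ger0_norm ?subr_ge0//; apply: H1; first by rewrite sb ltW.
by apply: le_lt_trans ts1; rewrite distrC ler_norm.
Qed.

Lemma arc_length_surj u : (0 <= u <= v b)%R ->
  exists2 t, (a <= t <= b)%R & v t = u.
Proof.
move=> /andP[u0 ul].
have [|t + vt] := @IVT R v a b u ab arc_length_continuous.
  by rewrite arc_length_start ge_min u0 le_max ul orbT.
by rewrite in_itv/= => tab; exists t.
Qed.

(** The curve does not move among the parameters at which the length is [v t], and
    its continuity extends this to their infimum. *)
Lemma arclength_paramE t : (a <= t <= b)%R -> arclength_param c (v t) = c t.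
Proof.
move=> tab; rewrite /arclength_param -/a.
set S := [set _ | _]; set i := inf S.
have St : S t by split; rewrite ?in_itv//= arc_lengthE.
have lbS : lbound S a by move=> s [] /=; rewrite in_itv => /andP[].
have hS : has_inf S by split; [exists t|exists a].
have iab : (a <= i <= b)%R.
  rewrite (@lb_le_inf _ _ _ _ lbS)//=; last by exists t.
  by apply: (@le_trans _ _ t); [apply: (ge_inf hS.2)|case/andP: tab].
have cS s : S s -> c s = c t.
  move=> [/=]; rewrite in_itv/= -/a => sab; rewrite arc_lengthE// => -[vst].
  apply: mdist_positivity; apply/eqP; rewrite eq_le mdist_ge0 andbT.
  by rewrite (le_trans (mdist_le_arc_length sab tab))// vst subrr normr0.
apply: mdist_positivity; apply/eqP; rewrite eq_le mdist_ge0 andbT.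
apply/ler_addgt0Pl => e e0; rewrite addr0.
have [d d0 Hd] := curve_modulus iab e0.
have [s Ss si] := inf_adherent d0 hS.
have is_ : (i <= s)%R by apply: (ge_inf hS.2).
have sab : (a <= s <= b)%R by case: Ss => /=; rewrite in_itv.
rewrite -(cS s Ss) ltW// Hd// distrC ger0_norm ?subr_ge0// ltrBlDl//.
Qed.

Lemma arclength_param_lipschitz u1 u2 : (0 <= u1 <= v b)%R -> (0 <= u2 <= v b)%R ->
  (mdist (arclength_param c u1) (arclength_param c u2) <= `|u1 - u2|)%R.
Proof.
move=> /arc_length_surj[t1 t1ab <-] /arc_length_surj[t2 t2ab <-].
by rewrite !arclength_paramE// mdist_le_arc_length.
Qed.

End arc_length.

(** * Subcurves and sets met in zero length *)

Section lebesgue_translation.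
Context (R : realType).
Local Notation lambda := (@lebesgue_measure R).

Lemma lebesgue_measure_shift (w : R) (A : set (measurableTypeR R)) :
  measurable A -> lambda [set x | A (x + w)%R] = lambda A.
Proof.
move=> mA; pose h : measurableTypeR R -> measurableTypeR R := fun x => (x + w)%R.
have mh : measurable_fun setT h by exact: measurable_funD.
apply/esym; have := @lebesgue_measure_unique R (pushforward lambda h).
apply => // _ [[x y] /= _ <-].
rewrite /pushforward.
have -> : h @^-1` `]x, y]%classic = `](x - w)%R, (y - w)%R]%classic.
  by apply/seteqP; split => z; rewrite /h/= !in_itv/= ltrBlDr lerBrDr.
rewrite !lebesgue_measure_itv/= !lte_fin ltrD2r; case: ifPn => // _.
by rewrite -!EFinB; congr EFin; rewrite opprB addrA subrK.
Qed.

Lemma negligible_shift (w : R) (A : set R) :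
  lambda.-negligible A -> lambda.-negligible [set x | A (x + w)%R].
Proof.
move=> [B [mB B0 AB]]; exists [set x | B (x + w)%R]; split; last by move=> x /AB.
  rewrite -[X in measurable X]setTI.
  by apply: (@measurable_funD _ _ R setT id (cst w)).
by rewrite lebesgue_measure_shift.
Qed.

Lemma not_negligible_interval (x y : R) (A : set R) : lambda.-negligible A ->
  (x < y)%R -> exists2 u, (x < u < y)%R & ~ A u.
Proof.
move=> nA xy; apply: contrapT => H.
have sub : `]x, y[%classic `<=` A.
  move=> u /=; rewrite in_itv/= => uxy; apply: contrapT => Au.
  by apply: H; exists u.
case: nA => B [mB B0 AB]; have : lambda `]x, y[%classic = 0.
  apply: (@subset_measure0 _ (measurableTypeR R) _ lambda _ B) => //.
  exact: subset_trans AB.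
rewrite lebesgue_measure_itv/= lte_fin xy -EFinB => -[]/eqP.
by rewrite subr_eq0 gt_eqF.
Qed.

End lebesgue_translation.

Section subcurve.
Context (R : realType) (X : metricType R).
Variable c : curve X.
Local Notation a := (cstart c).
Local Notation b := (cend c).
Variables s t : R.
Hypotheses (as_ : (a <= s)%R) (st : (s <= t)%R) (tb : (t <= b)%R).

Let sub_itv : `[s, t]%classic `<=` `[a, b]%classic.
Proof.
move=> u /=; rewrite !in_itv/= => /andP[su ut].
by rewrite (le_trans as_ su) (le_trans ut).
Qed.

Definition subcurve : curve X :=
  Curve st (continuous_subspaceW sub_itv (@curve_continuous _ _ c)).

Hypothesis rc : rectifiable c.

Lemma subcurve_rectifiable : rectifiable subcurve.
Proof.
by rewrite /rectifiable /curve_length /= arc_lengthB// ltry.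
Qed.

Lemma subcurve_length :
  curve_length subcurve = (arc_length c t - arc_length c s)%:E.
Proof. by rewrite /curve_length /= arc_lengthB. Qed.

Lemma subcurve_arc_length u : (s <= u <= t)%R ->
  arc_length subcurve u = (arc_length c u - arc_length c s)%R.
Proof.
move=> /andP[su ut].
by rewrite {1}/arc_length /= (arc_lengthB rc as_ su (le_trans ut tb)).
Qed.

(** The arc-length parametrization of a subcurve is a translate of that of the
    curve, so line integrals and null sets of parameters are inherited. *)
Lemma subcurve_arclength_param u :
  (0 <= u <= arc_length c t - arc_length c s)%R ->
  arclength_param subcurve u = arclength_param c (u + arc_length c s).
Proof.
move=> uI.
have [|r rst <-] := @arc_length_surj _ _ _ subcurve_rectifiable u.
  by rewrite subcurve_arc_length ?lexx ?st.
have {}rst : (s <= r <= t)%R := rst.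
rewrite arclength_paramE//; last exact: subcurve_rectifiable.
rewrite subcurve_arc_length// subrK arclength_paramE//.
by apply/andP; case/andP: rst => sr rt; rewrite (le_trans as_ sr) (le_trans rt tb).
Qed.

End subcurve.

Section null_length.
Context (R : realType) (X : metricType R).
Implicit Types (c : curve X) (N : set X).

(** The curve [c] meets [N] in zero length.  The parameter is the arc length, with
    respect to which line integrals are taken. *)
Definition null_length N c : Prop :=
  (@lebesgue_measure R).-negligible
    [set u | (0 <= u <= fine (curve_length c))%R /\ N (arclength_param c u)].

Lemma null_lengthS N N' c : N `<=` N' -> null_length N' c -> null_length N c.
Proof. by move=> NN'; apply: negligibleS => u [uI /NN']. Qed.

Lemma null_length_subcurve N c s t
    (as_ : (cstart c <= s)%R) (st : (s <= t)%R) (tb : (t <= cend c)%R) :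
  rectifiable c -> null_length N c -> null_length N (subcurve as_ st tb).
Proof.
move=> rc /(negligible_shift (arc_length c s)); apply: negligibleS => u [].
rewrite subcurve_length// => uI; rewrite subcurve_arclength_param// => Nu; split => //.
case/andP: uI => u0; rewrite lerBrDr => ut.
have tbl : (arc_length c t <= fine (curve_length c))%R.
  by apply: arc_length_le => //; exact: le_trans as_ st.
rewrite (le_trans ut tbl) andbT addr_ge0//.
by rewrite -(arc_length_start c) arc_length_le// (le_trans st).
Qed.

Lemma nonconstant_length c : rectifiable c -> nonconstant c ->
  (0 < fine (curve_length c))%R.
Proof.
move=> rc [s [t [sab tab cst]]].
rewrite lt_neqAle fine_ge0 ?path_length_ge0 ?cstart_le_cend// andbT.
apply/eqP => l0; apply: cst; apply: mdist_positivity; apply/eqP.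
rewrite eq_le mdist_ge0 andbT; move: sab tab; rewrite !in_itv/= => sab tab.
apply: (le_trans (mdist_le_arc_length rc sab tab)).
have := arc_length_itv rc sab; have := arc_length_itv rc tab.
rewrite -[arc_length c (cend c)]/(fine (curve_length c)) -l0 => /le_anti <- /le_anti <-.
by rewrite subrr normr0.
Qed.

Lemma length_nonconstant c : rectifiable c -> (0 < fine (curve_length c))%R ->
  nonconstant c.
Proof.
move=> rc l0; apply: contrapT => nc; move: l0.
suff -> : curve_length c = 0 by rewrite /= ltxx.
rewrite /curve_length (@eq_path_length _ _ _ (cst (c (cstart c)))); last first.
  move=> x xab; apply: contrapT => cx; apply: nc; exists x, (cstart c).
  by rewrite !in_itv/= lexx cstart_le_cend.
apply/eqP; rewrite eq_le path_length_ge0 ?cstart_le_cend// andbT path_lengthE.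
apply: ge_ereal_sup => _ [p _ <-].
by elim: p {2}(cstart c) => //= x p IH y; rewrite mdistxx add0r.
Qed.

(** A null set of parameters contains no interval, and the arc length takes all
    values.  With [x] zero, or [y] the length of the curve, this produces points
    outside [N] close to an endpoint. *)
Lemma null_length_arc N c (x y : R) : rectifiable c -> null_length N c ->
  (0 <= x)%R -> (x < y)%R -> (y <= fine (curve_length c))%R ->
  exists2 t, (cstart c <= t <= cend c)%R & (x < arc_length c t < y)%R /\ ~ N (c t).
Proof.
move=> rc Nc x0 xy yl; have [u /andP[xu uy] Nu] := not_negligible_interval Nc xy.
have uI : (0 <= u <= fine (curve_length c))%R.
  by rewrite (le_trans x0 (ltW xu)) (le_trans (ltW uy)).
have [t tab vt] := arc_length_surj rc uI; exists t => //.
rewrite vt xu uy; split => // Nct; apply: Nu; split => //.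
by rewrite -vt arclength_paramE.
Qed.

End null_length.

(** * Line integrals of Borel functions *)

Section line_integrals.
Context (R : realType) (X : completeMetricType R).
Implicit Types (c : curve X) (N : set X) (g : X -> \bar R).
Local Notation lambda := (@lebesgue_measure R).
Local Notation len c := (fine (curve_length c)).
Local Notation borel := (g_sigma_algebraType (@open X)).

(** Clamping the parameter extends the arc-length parametrization to a
    continuous function on the line. *)
Lemma measurable_arclength_param c : rectifiable c ->
  measurable_fun (`[0%R, len c]%classic : set (measurableTypeR R))
    (arclength_param c : measurableTypeR R -> borel).
Proof.
move=> rc; have l0 : (0 <= len c)%R.
  by rewrite fine_ge0 ?path_length_ge0 ?cstart_le_cend.
pose k (u : R) := Num.max 0%R (Num.min u (len c)).
have kI u : (0 <= k u <= len c)%R.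
  by rewrite /k le_max lexx/= ge_max l0 ge_min lexx orbT.
have kE u : (0 <= u <= len c)%R -> k u = u.
  by move=> /andP[u0 ul]; rewrite /k min_l// max_r.
have k_lip u1 u2 : (`|k u1 - k u2| <= `|u1 - u2|)%R.
  wlog u12 : u1 u2 / (u1 <= u2)%R.
    move=> H; have [|/ltW u21] := leP u1 u2; first exact: H.
    by rewrite distrC (distrC u1); exact: H.
  rewrite [leRHS]ler0_norm ?subr_le0// ler_norml /k.
  by case: (leP u1 (len c)) => ?; case: (leP u2 (len c)) => ?;
    repeat (case: (leP 0%R _) => ?); lra.
have h_cont : continuous (arclength_param c \o k : R -> X).
  move=> x; apply/metricType_numDomainType.cvgrPdist_lt => e e0.
  apply/nbhs_ballP; exists e => // y xy.
  apply: (le_lt_trans (arclength_param_lipschitz rc (kI x) (kI y))).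
  exact: (le_lt_trans (k_lip x y) xy).
apply: (@measurability _ _ _ borel _ _ (@open X)) => //.
move=> _ [U oU <-].
rewrite (_ : _ `&` _ = `[0%R, len c]%classic `&` (arclength_param c \o k) @^-1` U).
  apply: measurableI; first exact: measurable_itv.
  by apply: open_measurable; apply: open_comp => // x _; exact: h_cont.
by apply/seteqP; split => u /= [uI]; rewrite kE//; move: uI; rewrite in_itv.
Qed.

Lemma line_integral_cst c (r : R) : rectifiable c ->
  line_integral c (cst r%:E) = r%:E * curve_length c.
Proof.
move=> rc; pose I := `[0%R, len c]%classic : set (measurableTypeR R).
have mI : measurable I by exact: measurable_itv.
rewrite [LHS](integral_cst lambda mI); congr (_ * _).
rewrite -[LHS]/(lambda I) /I.
have l0 : 0 <= curve_length c by rewrite path_length_ge0// cstart_le_cend.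
have lfin : curve_length c \is a fin_num by rewrite ge0_fin_numE.
rewrite lebesgue_measure_itv/= lte_fin; case: ifPn => [_|]; first by rewrite oppr0 adde0 fineK.
by rewrite -leNgt -lee_fin fineK// => l00; rewrite (le_anti (introT andP (conj l00 l0))).
Qed.

Lemma line_integral_le c N g (r : R) : rectifiable c -> null_length N c ->
  borel_fun g -> (forall x, 0 <= g x) -> (0 <= r)%R ->
  (forall x, ~ N x -> g x <= r%:E) -> line_integral c g <= r%:E * curve_length c.
Proof.
move=> rc Nc mg g0 r0 gr; rewrite -line_integral_cst//.
apply: ae_ge0_le_integral => //.
  exact: (measurableT_comp mg (measurable_arclength_param rc)).
have [B [mB B0 NB]] := Nc; exists B; split => // u /not_implyP[uI gu].
apply: NB; split; last by move: gu; apply: contra_notP => /gr.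
by move: uI; rewrite /= in_itv.
Qed.

Lemma line_integral_ge0 c g : (forall x, 0 <= g x) -> 0 <= line_integral c g.
Proof. by move=> g0; apply: integral_ge0 => u _; exact: g0. Qed.

(** When [N] is null this has essential norm [r], and yet it forgives every curve
    that spends positive length in [N]. *)
Definition blow_up N (r : R) : X -> \bar R := patch (cst r%:E) N (cst +oo).

Lemma blow_up_ge0 N r x : (0 <= r)%R -> 0 <= blow_up N r x.
Proof. by move=> r0; rewrite /blow_up /patch; case: ifPn => // _; exact: leey. Qed.

Lemma borel_blow_up N r : borel_set N -> borel_fun (blow_up N r).
Proof.
move=> bN; apply: (@measurable_fun_ifT _ _ borel _ _ _ (fun x => x \in N)) => //.
apply: (@measurable_fun_bool _ borel _ _ true).
rewrite (_ : _ `&` _ = N)//; apply/seteqP; split => x /=.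
  by move=> [_ /set_mem].
by move=> /mem_set.
Qed.

Lemma line_integral_blow_up c N (r : R) : rectifiable c -> borel_set N ->
  (0 <= r)%R -> ~ null_length N c -> line_integral c (blow_up N r) = +oo.
Proof.
move=> rc bN r0 nN; pose I := `[0%R, len c]%classic : set (measurableTypeR R).
pose A := I `&` arclength_param c @^-1` N.
have mA : measurable A by apply: measurable_arclength_param => //; exact: measurable_itv.
have A0 : lambda A != 0.
  apply/eqP => A0; apply: nN; exists A; split => //.
apply/eqP; rewrite -leye_eq.
apply: (@le_trans _ _ (\int[lambda]_(u in A) (cst +oo) u)).
  by rewrite integral_cst// gt0_mulye// lt0e A0 measure_ge0.
rewrite (@eq_integral _ _ _ lambda A (blow_up N r \o arclength_param c)); last first.
  by move=> u /[!inE] -[_ Nu]; rewrite /= /blow_up /patch mem_set.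
apply: ge0_subset_integral => //; last exact: subIsetl.
- exact: (measurableT_comp (borel_blow_up _ bN) (measurable_arclength_param rc)).
- by move=> u _; exact: blow_up_ge0.
Qed.

Lemma line_integral_blow_up_ge c N (r : R) : rectifiable c -> borel_set N ->
  (0 <= r)%R -> r%:E * curve_length c <= line_integral c (blow_up N r).
Proof.
move=> rc bN r0; rewrite -line_integral_cst//; apply: ge0_le_integral => //.
  exact: (measurableT_comp (borel_blow_up _ bN) (measurable_arclength_param rc)).
by move=> u _; rewrite /blow_up /patch; case: ifPn => // _; exact: leey.
Qed.

End line_integrals.

(** * Essential bounds and null sets *)

(** Instance resolution does not see through [cmeas]. *)
#[global] Instance ae_cmeas_filter (R : realType) (X : completeMetricType R)
  (mu : {outer_measure set X -> \bar R}) : Filter (nbhs (almost_everywhere (cmeas mu))).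
Proof. exact: (@ae_filter_ringOfSetsType _ (caratheodory_type mu)). Qed.

Lemma lipschitz_borel (R : realType) (X : completeMetricType R) (f : X -> R) (L : R) :
  is_lipschitz_constant f L -> borel_fun f.
Proof.
move=> [L0 fL]; apply: (@measurability _ _ (g_sigma_algebraType (@open X)) _ _ _
  _ (RGenOInfty.measurableE R)) => //.
move=> _ [_ [r ->] <-]; apply: sub_sigma_algebra; rewrite setTI.
rewrite openE => x /=; rewrite in_itv/= andbT => rx; apply/nbhs_ballP.
have L1 : (0 < L + 1)%R by rewrite ltr_wpDl.
have fr : (0 < f x - r)%R by rewrite subr_gt0.
have e0 : (0 < (f x - r) / (L + 1))%R by rewrite divr_gt0.
exists ((f x - r) / (L + 1))%R => // y; rewrite ballEmdist /= ltr_pdivlMr// => xy.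
rewrite in_itv/= andbT; have := fL x y; rewrite ler_norml => /andP[_].
by have := mdist_ge0 x y; move: xy; nra.
Qed.

Section essential_bounds.
Context (R : realType) (X : completeMetricType R).
Variable mu : {outer_measure set X -> \bar R}.
Hypothesis br : borel_regular mu.
Hypothesis mu_gt0 : 0 < mu [set: X].
Implicit Types (f g : X -> \bar R) (P : X -> Prop).

Lemma borel_fun_measurable d (Y : measurableType d) (f : X -> Y) :
  borel_fun f -> measurable_fun [set: caratheodory_type mu] f.
Proof.
by move=> mf _ B mB; apply: br.1; exact: (mf measurableT B mB).
Qed.

Lemma aeP P : (\forall x \ae cmeas mu, P x) <-> mu (~` [set x | P x]) = 0.
Proof.
split=> [[B [_ B0 PB]]|P0].
  by apply/eqP; rewrite eq_le outer_measure_ge0 andbT -B0; exact: le_outer_measure.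
exists (~` [set x | P x]); split => //.
apply: le_caratheodory_measurable => Y.
rewrite [X in X + _](_ : _ = 0) ?add0e; last first.
  apply/eqP; rewrite eq_le outer_measure_ge0 andbT -P0; apply: le_outer_measure.
  exact: subIsetr.
by apply: le_outer_measure; exact: subIsetl.
Qed.

(** Borel regularity upgrades the exceptional set to a Borel one. *)
Lemma ae_borel P : (\forall x \ae cmeas mu, P x) ->
  exists N, [/\ borel_set N, mu N = 0 & forall x, ~ N x -> P x].
Proof.
move=> /aeP P0; have [N [bN PN mN]] := br.2 (~` [set x | P x]).
exists N; split => //; first by rewrite -mN.
by move=> x Nx; apply: contrapT => /PN.
Qed.

Lemma borel_ae P N : mu N = 0 -> (forall x, ~ N x -> P x) ->
  \forall x \ae cmeas mu, P x.
Proof.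
move=> N0 NP; apply/aeP; apply/eqP.
rewrite eq_le outer_measure_ge0 andbT -N0; apply: le_outer_measure => x /= Px.
by apply: contrapT => /NP.
Qed.

Lemma Linfty_normE f : Linfty_norm mu f = ess_sup (cmeas mu) (abse \o f).
Proof. by rewrite /Linfty_norm unlock mu_gt0. Qed.

Lemma Linfty_normP f (r : \bar R) :
  Linfty_norm mu f <= r <-> \forall x \ae cmeas mu, `|f x| <= r.
Proof. by rewrite Linfty_normE; split => /ess_supP. Qed.

Lemma Linfty_norm_ge0 f : 0 <= Linfty_norm mu f.
Proof. exact: Lnorm_ge0. Qed.

Lemma Linfty_fin_num f : Linfty_norm mu f < +oo -> Linfty_norm mu f \is a fin_num.
Proof. by rewrite ge0_fin_numE// Linfty_norm_ge0. Qed.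

Lemma Linfty_norm_cst (r : R) : (0 <= r)%R -> Linfty_norm mu (cst r%:E) = r%:E.
Proof.
move=> r0; rewrite Linfty_normE -[RHS](@ess_sup_cst _ _ _ (cmeas mu))//.
by congr ess_sup; apply/funext => x /=; rewrite ger0_norm.
Qed.

Lemma Linfty_norm_blow_up N (r : R) : mu N = 0 -> (0 <= r)%R ->
  Linfty_norm mu (blow_up N r) <= r%:E.
Proof.
move=> N0 r0; apply/Linfty_normP; apply: (borel_ae N0) => x Nx.
by rewrite /blow_up /patch memNset//= ger0_norm.
Qed.

(** Away from a null set met in zero length, an essentially bounded weak upper
    gradient acts as its bound, and no curve is exceptional: a curve of finite
    length cannot have integral at least one for functions that are at most
    arbitrarily small constants along it. *)
Lemma weak_upper_gradient_lipschitz f g (G : R) : weak_upper_gradient mu f g ->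
  (0 <= G)%R -> Linfty_norm mu g <= G%:E ->
  exists N, [/\ borel_set N, mu N = 0 & forall c : curve X, rectifiable c ->
    nonconstant c -> null_length N c ->
    `|f (c (cstart c)) - f (c (cend c))| <= G%:E * curve_length c].
Proof.
move=> [bg g0 [Gamma [GU Gamma0 Hug]]] G0 gG.
have /choice[rho Hrho] : forall n, exists rho : X -> \bar R,
    [/\ borel_fun rho, (forall x, 0 <= rho x),
      (forall c, Gamma c -> 1 <= line_integral c rho) &
      Linfty_norm mu rho <= (n.+1%:R^-1)%:E].
  move=> n; have : Mod_oo mu Gamma < (n.+1%:R^-1)%:E.
    by rewrite Gamma0 lte_fin invr_gt0.
  by move=> /ereal_inf_lt[_ [rho [? ? ?] <-] /ltW]; exists rho.
have [N [bN N0 HN]] : exists N, [/\ borel_set N, mu N = 0 & forall x, ~ N x ->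
    g x <= G%:E /\ forall n, rho n x <= (n.+1%:R^-1)%:E].
  have gG' : \forall x \ae cmeas mu, g x <= G%:E.
    by apply: filterS ((Linfty_normP _ _).1 gG) => x; rewrite gee0_abs.
  have rhoG : \forall x \ae cmeas mu, forall n, rho n x <= (n.+1%:R^-1)%:E.
    apply: ae_foralln => n; have [_ r0 _ rn] := Hrho n.
    by apply: filterS ((Linfty_normP _ _).1 rn) => x; rewrite gee0_abs.
  by apply: ae_borel; apply: filterS2 gG' rhoG.
exists N; split => // c rc ncc Nc.
have [Gc|nGc] := pselect (Gamma c); last first.
  apply: (le_trans (Hug _ (conj (conj rc ncc) nGc))).
  by apply: (line_integral_le rc Nc) => // x /HN[].
exfalso; have lfin : curve_length c \is a fin_num.
  by rewrite ge0_fin_numE// path_length_ge0// cstart_le_cend.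
have [n Hn] : exists n : nat, (fine (curve_length c) < n.+1%:R)%R.
  exists (Num.truncn (fine (curve_length c))); exact: truncnS_gt.
have [brho r0 /(_ c Gc) r1 _] := Hrho n.
have /(le_trans r1) : line_integral c (rho n) <= (n.+1%:R^-1)%:E * curve_length c.
  by apply: (line_integral_le rc Nc) => // x /HN[].
rewrite -(fineK lfin) -EFinM lee_fin leNgt => /negP; apply.
by rewrite mulrC ltr_pdivrMr// mul1r.
Qed.

End essential_bounds.

(** * Separated nets in doubling spaces *)

Section doubling_space.
Context (R : realType) (X : completeMetricType R).
Variable mu : {outer_measure set X -> \bar R}.
Hypothesis br : borel_regular mu.
Variable D : R.
Hypothesis D1 : (1 <= D)%R.
Hypothesis ball_pos : forall (x : X) (r : R), (0 < r)%R -> 0 < mu (ball x r) < +oo.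
Hypothesis mu_double : forall (x : X) (r : R), (0 < r)%R ->
  mu (ball x (2 * r)%R) <= D%:E * mu (ball x r).
Implicit Types (x y : X) (r : R).
Local Notation nu := (cmeas mu).
Local Notation T := (caratheodory_type mu).

Lemma ball_fin_num x r : (0 < r)%R -> mu (ball x r) \is a fin_num.
Proof. by move=> /(ball_pos x)/andP[/ltW ? ?]; rewrite ge0_fin_numE. Qed.

Lemma measurable_ball_cmeas x r : measurable (ball x r : set T).
Proof.
apply: br.1; apply: sub_sigma_algebra.
rewrite openE => y; rewrite ballEmdist /= => xy; apply/nbhs_ballP.
exists (r - mdist x y)%R; first by rewrite /= subr_gt0.
move=> z; rewrite !ballEmdist/= ltrBrDl; apply: le_lt_trans.
exact: metric_triangle.
Qed.

Lemma sub_ball x y r s : (mdist x y + r <= s)%R -> ball y r `<=` ball x s.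
Proof.
move=> yxr z; rewrite !ballEmdist/= => yz; apply: le_lt_trans (metric_triangle x y z) _.
by apply: lt_le_trans yxr; rewrite ltrD2l.
Qed.

Lemma le_ball_measure x y r s : (mdist x y + r <= s)%R ->
  mu (ball y r) <= mu (ball x s).
Proof. by move=> /sub_ball; exact: le_outer_measure. Qed.

Lemma mu_double_iter k x r : (0 < r)%R ->
  mu (ball x (2 ^+ k * r)%R) <= (D ^+ k)%:E * mu (ball x r).
Proof.
move=> r0; elim: k => [|k IH]; first by rewrite !expr0 mul1r mul1e.
rewrite exprS -mulrA; apply: (le_trans (mu_double _ _)).
  by rewrite mulr_gt0// exprn_gt0.
by rewrite exprS EFinM -muleA lee_pmul2l// lte_fin (lt_le_trans _ D1).
Qed.

(** The net is the family of the first [n] values of a sequence, so that a point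
    can be added to it without a change of index type. *)
Definition separated x0 r (e : R) n (F : nat -> X) : Prop :=
  (forall i, (i < n)%N -> (mdist x0 (F i) < r)%R) /\
  (forall i j, (i < j)%N -> (j < n)%N -> (e <= mdist (F i) (F j))%R).

Lemma separated_measure x0 r (e : R) n F : (0 < e)%R -> (e <= r)%R ->
  separated x0 r e n F ->
  \sum_(i < n) mu (ball (F i) (e / 2)%R) <= mu (ball x0 (2 * r)%R).
Proof.
move=> e0 er [Fr Fe].
have far i j (z : X) : (i < j)%N -> (j < n)%N ->
    ball (F i) (e / 2)%R z -> ball (F j) (e / 2)%R z -> False.
  move=> ij jn; rewrite !ballEmdist/= => iz jz.
  have := Fe i j ij jn; rewrite leNgt => /negP; apply.
  apply: le_lt_trans (metric_triangle _ z _) _.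
  by rewrite [e]splitr ltrD// metric_sym.
have <- : mu (\big[setU/set0]_(i < n) ball (F i) (e / 2)%R) =
    \sum_(i < n) mu (ball (F i) (e / 2)%R).
  apply: (@measure_bigsetU_ord _ _ T nu) => [i|]; first exact: measurable_ball_cmeas.
  move=> i j _ _ [z [iz jz]]; apply: val_inj => /=.
  case: (ltngtP i j) => // ij; exfalso; [exact: (far i j z)|exact: (far j i z)].
apply: le_outer_measure => z.
rewrite -(bigcup_mkord n (fun i => ball (F i) (e / 2)%R)) => -[i /= ilt].
apply: sub_ball; rewrite mulr_natl mulr2n; apply: lerD; first exact/ltW/Fr.
by apply: le_trans er; rewrite ler_pdivrMr// ler_pMr//; lra.
Qed.

(** A separated family of maximal cardinality is dense at its scale, since any
    point at distance at least [e] from it could be added.  The cardinality is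
    bounded because the half-balls are disjoint and, by doubling, each of them
    carries a fixed fraction of the measure of a common ball. *)
Lemma maximal_net x0 r (e : R) : (0 < e)%R -> (e <= r)%R ->
  exists n F, separated x0 r e n F /\
    forall y, (mdist x0 y < r)%R -> exists2 i, (i < n)%N & ball (F i) e y.
Proof.
move=> e0 er; have r0 : (0 < r)%R := lt_le_trans e0 er.
pose P := [pred n | `[< exists F, separated x0 r e n F >]].
have P0 : exists n, P n by exists 0%N; apply/asboolP; exists (fun=> x0).
(* [3 r] is a radius at which a ball centred at any net point contains the ball
   of radius [2 r] around [x0]. *)
have [k Hk] : exists k : nat, (3 * r <= 2 ^+ k * (e / 2))%R.
  exists (Num.bound (3 * r / (e / 2)))%R; rewrite -ler_pdivrMr ?divr_gt0// ltW//.
  by apply: upper_nthrootP; exact: leqnn.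
have Pbound n : P n -> (n <= (Num.truncn (D ^+ k)).+1)%N.
  move=> /asboolP[F /[dup] sF [Fr _]].
  have r20 : (0 < 2 * r)%R by rewrite mulr_gt0.
  have e20 : (0 < e / 2)%R by rewrite divr_gt0.
  have /andP[m0 moo] := ball_pos x0 r20.
  have Dk0 : (0 < D ^+ k)%R by rewrite exprn_gt0// (lt_le_trans _ D1).
  have low i : (i < n)%N -> mu (ball x0 (2 * r)%R) <= (D ^+ k)%:E * mu (ball (F i) (e / 2)%R).
    move=> ilt; apply: le_trans (mu_double_iter k (F i) e20).
    apply: le_ball_measure; apply: le_trans Hk.
    by rewrite metric_sym; have := Fr i ilt; lra.
  have : (n%:R)%:E * mu (ball x0 (2 * r)%R) <= (D ^+ k)%:E * mu (ball x0 (2 * r)%R).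
    apply: le_trans (_ : (D ^+ k)%:E * \sum_(i < n) mu (ball (F i) (e / 2)%R) <= _); last first.
      by rewrite lee_pmul2l//; exact: separated_measure.
    rewrite ge0_sume_distrr; last by move=> i _; exact: outer_measure_ge0.
    have -> : n%:R%:E * mu (ball x0 (2 * r)%R) = \sum_(i < n) mu (ball x0 (2 * r)%R).
      by rewrite mule_natl sumr_const card_ord.
    by apply: lee_sum => i _; exact: low.
  rewrite lee_pmul2r ?ball_fin_num// lee_fin => nD.
  by rewrite -(ler_nat R) (le_trans nD)// ltW// truncnS_gt.
have [n /asboolP[F sF] nmax] := ex_maxnP P0 Pbound.
exists n, F; split => // y yr; apply: contrapT => Hy.
suff /nmax : P n.+1 by rewrite ltnn.
apply/asboolP; exists (fun i => if (i == n)%N then y else F i).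
case: sF => Fr Fe; split=> [i|i j].
  by rewrite ltnS leq_eqVlt; case: eqVneq => //= _; exact: Fr.
move=> ij; rewrite ltnS leq_eqVlt; case: (eqVneq j n) => /= [jn _|jn jlt].
  rewrite ltn_eqF ?jn// -?jn//.
  rewrite leNgt; apply/negP => lt_e; apply: Hy; exists i; first by rewrite -jn.
  by rewrite ballEmdist.
by rewrite ltn_eqF ?(ltn_trans ij)//; exact: Fe.
Qed.

End doubling_space.

(** * Oscillation of means over balls *)

Section mean_oscillation.
Context (R : realType) (X : completeMetricType R).
Variable mu : {outer_measure set X -> \bar R}.
Hypothesis br : borel_regular mu.
Variable D : R.
Hypothesis D1 : (1 <= D)%R.
Hypothesis ball_pos : forall (x : X) (r : R), (0 < r)%R -> 0 < mu (ball x r) < +oo.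
Hypothesis mu_double : forall (x : X) (r : R), (0 < r)%R ->
  mu (ball x (2 * r)%R) <= D%:E * mu (ball x r).
Implicit Types (x y : X) (r : R).
Local Notation nu := (cmeas mu).
Local Notation T := (caratheodory_type mu).

Lemma ge0_integral_bigsetU_le (phi : X -> \bar R) (A : nat -> set X) n :
  measurable_fun [set: T] phi -> (forall x, 0 <= phi x) ->
  (forall i, measurable (A i : set T)) ->
  \int[nu]_(x in \big[setU/set0]_(i < n) A i) phi x
    <= \sum_(i < n) \int[nu]_(x in A i) phi x.
Proof.
move=> mphi phi0 mA; elim: n => [|n IH]; first by rewrite !big_ord0 integral_set0.
have mU : measurable (\big[setU/set0]_(i < n) A i : set T).
  exact: bigsetU_measurable.
rewrite !big_ord_recr/=; set U := \big[setU/set0]_(i < n) A i in mU IH *.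
rewrite (_ : U `|` A n = U `|` (A n `\` U)); last first.
  apply/seteqP; split=> x [Ux|]; [by left| |by left|by move=> []; right].
  by move=> Ax; have [Ux|nUx] := pselect (U x); [left|right].
have mAU : measurable (A n `\` U : set T) by exact: measurableD.
rewrite ge0_integral_setU//; last 2 first.
- exact: measurable_funS mphi.
- rewrite disj_set2E; apply/eqP; rewrite -subset0 => x [Ux [_ nUx]]; exact: nUx.
apply: leeD => //; apply: ge0_subset_integral => //.
exact: measurable_funS mphi.
Qed.

(** Cover a fixed ball by the balls of radius [e] around a maximal net.  Their
    measures add up, by doubling and disjointness of the half-balls, to at most a
    constant independent of [e], so the integral over the fixed ball is at most a
    multiple of [e]. *)
Lemma ae0_of_ball_integrals (phi : X -> \bar R) (K : R) :
  measurable_fun [set: T] phi -> (forall x, 0 <= phi x) -> (0 <= K)%R ->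
  (forall x r, (0 < r)%R ->
    \int[nu]_(y in ball x r) phi y <= (K * r)%:E * mu (ball x r)) ->
  \forall x \ae nu, phi x = 0.
Proof.
move=> mphi phi0 K0 Hphi; pose x0 : X := point.
have D0 : (0 < D)%R := lt_le_trans ltr01 D1.
have mball x r : measurable (ball x r : set T) := measurable_ball_cmeas br x r.
have small r (e : R) : (0 < e)%R -> (e <= r)%R ->
    \int[nu]_(y in ball x0 r) phi y <= (K * e * D)%:E * mu (ball x0 (2 * r)%R).
  move=> e0 er.
  have [n [F [sF cF]]] := maximal_net br D1 ball_pos mu_double x0 e0 er.
  apply: (@le_trans _ _ (\int[nu]_(y in \big[setU/set0]_(i < n) ball (F i) e) phi y)).
    apply: ge0_subset_integral => //.
    - by apply: bigsetU_measurable.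
    - exact: measurable_funS mphi.
    move=> y; rewrite ballEmdist /= => /cF[i ilt Fiy].
    by rewrite -(bigcup_mkord n (fun i => ball (F i) e)); exists i.
  apply: (le_trans (@ge0_integral_bigsetU_le _ (fun i => ball (F i) e) n mphi phi0 _)) => //.
  apply: le_trans (_ : (K * e * D)%:E * \sum_(i < n) mu (ball (F i) (e / 2)%R) <= _); last first.
    by apply: lee_wpmul2l; [rewrite lee_fin !mulr_ge0// ltW|exact: separated_measure sF].
  rewrite ge0_sume_distrr; last by move=> i _; exact: outer_measure_ge0.
  apply: lee_sum => i _; apply: (le_trans (Hphi _ _ e0)).
  rewrite [in leRHS]EFinM -muleA; apply: lee_wpmul2l.
    by rewrite lee_fin mulr_ge0// ltW.
  rewrite [e in leLHS](_ : e = 2 * (e / 2))%R; first by apply: mu_double; rewrite divr_gt0.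
  by rewrite mulrC divfK.
have zero r : (0 < r)%R -> \int[nu]_(y in ball x0 r) phi y = 0.
  move=> r0; apply/eqP; rewrite eq_le integral_ge0// andbT.
  apply/lee_addgt0Pr => e e0; rewrite add0e.
  have r20 : (0 < 2 * r)%R by rewrite mulr_gt0.
  set m := fine (mu (ball x0 (2 * r)%R)).
  have mE : mu (ball x0 (2 * r)%R) = m%:E by rewrite fineK// ball_fin_num.
  have m0 : (0 <= m)%R by rewrite fine_ge0.
  have C0 : (0 < K * D * m + 1)%R by rewrite ltr_wpDl// !mulr_ge0// ltW.
  pose e' := Num.min r (e / (K * D * m + 1))%R.
  have e'0 : (0 < e')%R by rewrite lt_min r0 divr_gt0.
  have e'r : (e' <= r)%R by rewrite ge_min lexx.
  apply: (le_trans (small r e' e'0 e'r)); rewrite mE -EFinM lee_fin.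
  have : (e' <= e / (K * D * m + 1))%R by rewrite ge_min lexx orbT.
  rewrite ler_pdivlMr//; apply: le_trans.
  rewrite (_ : K * e' * D * m = e' * (K * D * m))%R; last by lra.
  by rewrite ler_wpM2l ?ltW// ltrDl.
have : \forall x \ae nu, forall n : nat, ball x0 n.+1%:R x -> phi x = 0.
  apply: ae_foralln => n.
  have : \int[nu]_(x in ball x0 n.+1%:R) `|phi x| = 0.
    rewrite -[RHS](zero n.+1%:R (ltr0Sn _ n)); apply: eq_integral => x _.
    by rewrite gee0_abs.
  move=> /ae_eq_integral_abs; apply => //; exact: measurable_funS mphi.
apply: filterS => x Hx; apply: (Hx (Num.truncn (mdist x0 x))).
by rewrite ballEmdist /= truncnS_gt.
Qed.

End mean_oscillation.

Section lipschitz_representative.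
Context (R : realType) (X : completeMetricType R).
Variable mu : {outer_measure set X -> \bar R}.
Hypothesis br : borel_regular mu.
Variable D : R.
Hypothesis D1 : (1 <= D)%R.
Hypothesis ball_pos : forall (x : X) (r : R), (0 < r)%R -> 0 < mu (ball x r) < +oo.
Hypothesis mu_double : forall (x : X) (r : R), (0 < r)%R ->
  mu (ball x (2 * r)%R) <= D%:E * mu (ball x r).
Local Notation nu := (cmeas mu).
Local Notation T := (caratheodory_type mu).

Variables (u : X -> R) (M K : R).
Hypothesis mu_u : measurable_fun [set: T] u.
Hypothesis uM : forall x, (`|u x| <= M)%R.
Hypothesis K0 : (0 <= K)%R.
Hypothesis osc : forall x r, (0 < r)%R ->
  \int[nu]_(y in ball x r) `| (u y)%:E - average mu (ball x r) (EFin \o u) |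
    <= (K * r)%:E * mu (ball x r).
Implicit Types (x y : X) (r s : R).

Let D0 : (0 < D)%R := lt_le_trans ltr01 D1.
Let mball x r : measurable (ball x r : set T) := measurable_ball_cmeas br x r.

Definition mean x r : R := fine (average mu (ball x r) (EFin \o u)).

Let integrable_bounded (f : X -> R) (C : R) x r :
  measurable_fun [set: T] f -> (forall x, (`|f x| <= C)%R) -> (0 < r)%R ->
  nu.-integrable (ball x r) (EFin \o f).
Proof.
move=> mf fC r0; apply: measurable_bounded_integrable => //.
- by case/andP: (ball_pos x r0).
- exact: measurable_funS mf.
exists C; split; first exact: num_real.
by move=> C' CC' y _; exact: le_trans (fC y) (ltW CC').
Qed.

Let integrable_u x r (r0 : (0 < r)%R) := integrable_bounded x mu_u uM r0.

Lemma averageE x r : (0 < r)%R ->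
  average mu (ball x r) (EFin \o u) = (mean x r)%:E.
Proof.
move=> r0; have [b0 boo] := andP (ball_pos x r0).
rewrite /mean /average fineK// fin_numM//.
  exact: (integrable_fin_num (mball x r) (integrable_u x r0)).
by rewrite fin_numV// ?gt_eqF// (lt_trans _ b0)// ltNy0.
Qed.

Lemma integral_mean x r : (0 < r)%R ->
  \int[nu]_(y in ball x r) (u y)%:E = (mean x r)%:E * mu (ball x r).
Proof.
move=> r0; have [b0 _] := andP (ball_pos x r0).
rewrite -averageE// /average -muleA mulVe ?mule1 ?gt_eqF//.
exact: (ball_fin_num ball_pos).
Qed.

Lemma mean_dist_le x y r s (k : R) : (0 < s)%R -> ball y s `<=` ball x r ->
  (`|mean y s - k|)%:E * mu (ball y s)
    <= \int[nu]_(z in ball x r) (`|u z - k|)%:E.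
Proof.
move=> s0 sub.
have mf : measurable_fun [set: T] (fun z => (`|u z - k|)%:E).
  apply/measurable_EFinP; apply: measurableT_comp => //.
  exact: measurable_funB.
apply: (@le_trans _ _ (\int[nu]_(z in ball y s) (`|u z - k|)%:E)); last first.
  by apply: ge0_subset_integral => //; exact: measurable_funS mf.
have -> : (`|mean y s - k|)%:E * mu (ball y s) = `| \int[nu]_(z in ball y s) (u z - k)%:E |.
  rewrite (_ : \int[nu]_(z in ball y s) (u z - k)%:E =
      \int[nu]_(z in ball y s) ((u z)%:E - k%:E))//.
  rewrite (@integralB_EFin _ T R nu _ u (cst k))//; last 2 first.
  - exact: integrable_u.
  - by apply: (@integrable_bounded (cst k) `|k|%R).
  have -> : \int[nu]_(z in ball y s) (cst k z)%:E = k%:E * mu (ball y s).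
    exact: (integral_cst nu (mball y s) k%:E).
  have -> : \int[nu]_(z in ball y s) (u z)%:E = (mean y s)%:E * mu (ball y s).
    exact: integral_mean.
  rewrite -muleBl ?fin_num_adde_defl//; last exact: (ball_fin_num ball_pos).
  by rewrite abseM -EFinB/= [in RHS](gee0_abs (outer_measure_ge0 _ _)).
apply: le_trans (le_abse_integral _ _ _) _ => //.
by apply/measurable_EFinP; apply: measurable_funB => //; exact: measurable_funS mu_u.
Qed.

Lemma mean_oscillation x r : (0 < r)%R ->
  \int[nu]_(y in ball x r) (`|u y - mean x r|)%:E <= (K * r)%:E * mu (ball x r).
Proof. by move=> r0; have := osc x r0; rewrite averageE. Qed.

Lemma mean_bound x r : (0 < r)%R -> (`|mean x r| <= M)%R.
Proof.
move=> r0; have [b0 boo] := andP (ball_pos x r0).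
have := @mean_dist_le x x r r 0%R r0 (@subset_refl _ _).
rewrite subr0 => H; rewrite -lee_fin -(@lee_pmul2r _ (mu (ball x r)))//.
  apply: (le_trans H); rewrite -(integral_cst nu (mball x r)).
  apply: ge0_le_integral => //.
  - apply/measurable_EFinP; apply: measurableT_comp => //.
    by apply: measurable_funB => //; exact: measurable_funS mu_u.
  - by move=> y _ /=; rewrite lee_fin subr0.
exact: ball_fin_num.
Qed.

(** The mean over a smaller ball of comparable measure differs from the mean over
    the larger one by at most a multiple of the oscillation on the larger one. *)
Lemma mean_compare x y r s (C : R) : (0 < r)%R -> (0 < s)%R ->
  ball y s `<=` ball x r -> mu (ball x r) <= C%:E * mu (ball y s) ->
  (`|mean y s - mean x r| <= C * K * r)%R.
Proof.
move=> r0 s0 sub muC; have [b0 boo] := andP (ball_pos y s0).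
rewrite -lee_fin -(@lee_pmul2r _ (mu (ball y s)))//; last exact: ball_fin_num.
apply: (le_trans (mean_dist_le _ s0 sub)); apply: (le_trans (mean_oscillation _ r0)).
rewrite (_ : C * K * r = K * r * C)%R; last by lra.
by rewrite [in leRHS]EFinM -muleA; apply: lee_wpmul2l => //; rewrite lee_fin mulr_ge0// ltW.
Qed.

(** Each halving of the radius [r] costs [D * K * r]; the costs form a geometric
    series. *)
Lemma mean_shrink x r s : (0 < s)%R -> (s <= r)%R ->
  (`|mean x s - mean x r| <= 2 * D * K * r)%R.
Proof.
move=> s0 sr; have [k] : exists k : nat, (r <= 2 ^+ k * s)%R.
  exists (Num.bound (r / s))%R; rewrite -ler_pdivrMr// ltW//.
  by apply: upper_nthrootP; exact: leqnn.
have DK0 : (0 <= D * K)%R by rewrite mulr_ge0// ltW.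
elim: k r sr => [|k IH] r sr.
  rewrite expr0 mul1r => rs; rewrite (le_anti (introT andP (conj sr rs))) subrr normr0.
  by rewrite !mulr_ge0// ltW// (lt_le_trans s0).
have r0 : (0 < r)%R := lt_le_trans s0 sr.
have near t : (r / 2 <= t)%R -> (t <= r)%R -> (`|mean x t - mean x r| <= D * K * r)%R.
  move=> rt tr; have t0 : (0 < t)%R by apply: lt_le_trans rt; rewrite divr_gt0.
  apply: mean_compare => //; first exact: le_ball.
  apply: le_trans (mu_double _ t0); apply: le_outer_measure; apply: le_ball.
  by rewrite -ler_pdivrMl// mulrC.
have [rs _|sr2] := leP (r / 2)%R s.
  apply: (le_trans (near s rs sr)).
  by have := mulr_ge0 DK0 (ltW r0); lra.
rewrite exprS -mulrA -ler_pdivrMl// mulrC => /IH - /(_ (ltW sr2)) H.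
have := near (r / 2)%R (lexx _); rewrite ler_pdivrMr// ler_pMr// => /(_ ltac:(lra)).
have := ler_distD (mean x (r / 2)%R) (mean x s) (mean x r).
have -> : (2 * D * K * r = 2 * D * K * (r / 2) + D * K * r)%R by lra.
by move=> H1 H2; apply: (le_trans H1); apply: lerD.
Qed.

(** The limit of the means over balls shrinking to [x].  By [mean_shrink] the added
    error term turns every mean into an upper bound of the limit, which is
    therefore an infimum, and no sequence of radii has to be chosen. *)
Definition representative x : R :=
  inf [set (mean x r + 2 * D * K * r)%R | r in [set r : R | (0 < r)%R]].
Local Notation h := representative.

Lemma representative_mean x r : (0 < r)%R -> (`|h x - mean x r| <= 2 * D * K * r)%R.
Proof.
move=> r0; have DK0 : (0 <= 2 * D * K)%R by rewrite !mulr_ge0// ltW.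
have low s t : (0 < s)%R -> (0 < t)%R ->
    (mean x t - 2 * D * K * t <= mean x s + 2 * D * K * s)%R.
  move=> s0 t0; have [st|/ltW ts] := leP s t.
    have := mean_shrink x s0 st; rewrite ler_norml => /andP[].
    by have := mulr_ge0 DK0 (ltW s0); lra.
  have := mean_shrink x t0 ts; rewrite ler_norml => /andP[_].
  by have := mulr_ge0 DK0 (ltW t0); lra.
have lb t : (0 < t)%R -> lbound [set (mean x r + 2 * D * K * r)%R | r in [set r : R | (0 < r)%R]]
    (mean x t - 2 * D * K * t)%R.
  by move=> t0 _ [s s0 <-]; exact: low.
rewrite ler_distl; apply/andP; split.
  apply: lb_le_inf; last exact: lb.
  by exists (mean x 1 + 2 * D * K * 1)%R; exists 1%R => //=.
apply: ge_inf; first by exists (mean x 1 - 2 * D * K * 1)%R; exact: lb.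
by exists r.
Qed.

(** Compare the means over the ball of radius [r = mdist x y] around [x] and over
    the ball of radius [2 * r] around [y], which contains it. *)
Lemma representative_lipschitz x y :
  (`|h x - h y| <= 8 * D ^+ 2 * K * mdist x y)%R.
Proof.
have [->|xy] := eqVneq x y; first by rewrite subrr normr0 mdistxx mulr0.
(* 8 = 2 + 4 + 2: the errors of the two means as approximations of [h x] and
   [h y], and the distance between these means. *)
set r := mdist x y; have r0 : (0 < r)%R by rewrite mdist_gt0.
have r20 : (0 < 2 * r)%R by rewrite mulr_gt0.
have h1 := representative_mean x r0; have h2 := representative_mean y r20.
have h3 : (`|mean x r - mean y (2 * r)| <= D ^+ 2 * K * (2 * r))%R.
  apply: mean_compare => //.
    by apply: sub_ball; rewrite metric_sym -/r; lra.
  apply: le_trans (mu_double_iter D1 mu_double 2 x r0).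
  by apply: le_ball_measure; rewrite -/r; lra.
have DD : (D <= D ^+ 2)%R by rewrite expr2 ler_pMr.
have DKr : (D * (K * r) <= D ^+ 2 * (K * r))%R.
  by rewrite ler_wpM2r// mulr_ge0// ltW.
move: h1 h2 h3; rewrite !ler_norml => /andP[? ?] /andP[? ?] /andP[? ?].
by apply/andP; split; lra.
Qed.

Let lipschitz_representative : is_lipschitz_constant h (8 * D ^+ 2 * K).
Proof. by split; [rewrite !mulr_ge0// ltW|exact: representative_lipschitz]. Qed.

Lemma representative_measurable : measurable_fun [set: T] h.
Proof. exact: (borel_fun_measurable br (lipschitz_borel lipschitz_representative)). Qed.

(** On a ball of radius [r] around [x], both [u] on average and [h] pointwise are
    within a multiple of [K * r] of the mean of [u]. *)
Lemma representative_ae : \forall x \ae nu, u x = h x.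
Proof.
have mf : measurable_fun [set: T] (fun z => (`|u z - h z|)%:E).
  apply/measurable_EFinP; apply: measurableT_comp => //.
  by apply: measurable_funB => //; exact: representative_measurable.
have : \forall x \ae nu, (`|u x - h x|)%:E = 0.
  (* 11 = 1 + 8 + 2: the oscillation, the Lipschitz constant of [h], and the
     distance from [h x] to the mean. *)
  apply: (@ae0_of_ball_integrals _ _ _ br _ D1 ball_pos mu_double _ (11 * D ^+ 2 * K) mf) => //.
    by rewrite !mulr_ge0// ltW.
  move=> x r r0.
  have DD : (D * (K * r) <= D ^+ 2 * (K * r))%R.
    by rewrite expr2 ler_wpM2r ?ler_pMr// mulr_ge0// ltW.
  have KD : (K * r <= D ^+ 2 * (K * r))%R.
    by rewrite ler_peMl ?exprn_ege1// mulr_ge0// ltW.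
  apply: (@le_trans _ _ (\int[nu]_(y in ball x r)
      ((`|u y - mean x r|)%:E + cst (10 * D ^+ 2 * K * r)%:E y))).
    apply: ge0_le_integral => //.
    - exact: measurable_funS mf.
    - apply: emeasurable_funD => //; apply/measurable_EFinP; apply: measurableT_comp => //.
      by apply: measurable_funB => //; exact: measurable_funS mu_u.
    move=> y; rewrite ballEmdist /= => xyr; rewrite -EFinD lee_fin.
    have := representative_lipschitz x y; have := representative_mean x r0.
    have : (8 * D ^+ 2 * K * mdist x y <= 8 * D ^+ 2 * K * r)%R.
      by rewrite ler_wpM2l ?(ltW xyr)// !mulr_ge0// ltW.
    rewrite (_ : u y - h y = (u y - mean x r) + ((h x - h y) - (h x - mean x r)))%R; last by lra.
    move=> H1 H2 H3; apply: (le_trans (ler_normD _ _)); rewrite lerD2l.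
    by apply: (le_trans (ler_normB _ _)); lra.
  rewrite ge0_integralD//.
  - rewrite integral_cst// (_ : 11 * D ^+ 2 * K * r = D ^+ 2 * (K * r) + 10 * D ^+ 2 * K * r)%R; last by lra.
    rewrite EFinD muleDl ?fin_num_adde_defl//; last exact: ball_fin_num.
    rewrite leeD2r//; apply: (le_trans (mean_oscillation x r0)).
    by rewrite lee_wpmul2r// lee_fin.
  - apply/measurable_EFinP; apply: measurableT_comp => //.
    by apply: measurable_funB => //; exact: measurable_funS mu_u.
  - by move=> y _; rewrite lee_fin !mulr_ge0// ?exprn_ge0// ltW.
apply: filterS => x [] /eqP; rewrite normr_eq0 subr_eq0 => /eqP.
by [].
Qed.

Lemma ae_lipschitz : exists g : X -> R, [/\ is_lipschitz_constant g (8 * D ^+ 2 * K),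
  exists C, forall x, (`|g x| <= C)%R & \forall x \ae nu, u x = g x].
Proof.
exists h; split => //; last exact: representative_ae.
exists (M + 2 * D * K * 1)%R => x; rewrite -[h x](subrK (mean x 1)) addrC.
apply: (le_trans (ler_normD _ _)); apply: lerD; first exact: mean_bound.
exact: representative_mean.
Qed.

End lipschitz_representative.

(** * Lipschitz functions outside null sets *)

Section lipschitz_functions.
Context (R : realType) (X : completeMetricType R).
Variable mu : {outer_measure set X -> \bar R}.
Hypothesis br : borel_regular mu.
Hypothesis ball_pos : forall (x : X) (r : R), (0 < r)%R -> 0 < mu (ball x r) < +oo.
Implicit Types (f h : X -> R) (L G : R) (P : X -> Prop).

Lemma ae_dense P : (\forall x \ae cmeas mu, P x) ->
  forall x (e : R), (0 < e)%R -> exists2 y, (mdist x y < e)%R & P y.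
Proof.
move=> /aeP P0 x e e0; apply: contrapT => H.
have /andP[] := ball_pos x e0; rewrite lt_neqAle => /andP[/eqP + _] _; apply.
apply/eqP; rewrite eq_le outer_measure_ge0/= -P0; apply: le_outer_measure.
by move=> y; rewrite ballEmdist /= => xy Py; apply: H; exists y.
Qed.

(** The bound passes to the limit from points of [P] near [x] and [y]. *)
Lemma ae_lipschitz_constant f L G : is_lipschitz_constant f L -> (0 <= G)%R ->
  forall P, (\forall x \ae cmeas mu, P x) ->
  (forall x y, P x -> P y -> (`|f x - f y| <= G * mdist x y)%R) ->
  is_lipschitz_constant f G.
Proof.
move=> [L0 fL] G0 P aeP fP; split => // x y.
apply/ler_addgt0Pr => e e0.
pose d := (e / (2 * (L + G) + 1))%R.
have LG : (0 < 2 * (L + G) + 1)%R by rewrite ltr_wpDl// mulr_ge0// addr_ge0.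
have d0 : (0 < d)%R by rewrite divr_gt0.
have dE : (d * (2 * (L + G) + 1) = e)%R by rewrite divfK// gt_eqF.
have [x' xx' Px'] := ae_dense aeP x d0; have [y' yy' Py'] := ae_dense aeP y d0.
have h1 := fL x x'; have h2 := fL y y'; have h3 := fP x' y' Px' Py'.
have h4 : (mdist x' y' <= mdist x y + 2 * d)%R.
  have := metric_triangle x' x y'; have := metric_triangle x y y'.
  by rewrite (metric_sym x' x); lra.
have l1 : (L * mdist x x' <= L * d)%R by rewrite ler_wpM2l// ltW.
have l2 : (L * mdist y y' <= L * d)%R by rewrite ler_wpM2l// ltW.
have l3 : (G * mdist x' y' <= G * (mdist x y + 2 * d))%R by rewrite ler_wpM2l.
move: h1 h2 h3; rewrite !ler_norml => /andP[? ?] /andP[? ?] /andP[? ?].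
by apply/andP; split; lra.
Qed.

Lemma ae_lipschitz_le f L (C : R) : is_lipschitz_constant f L ->
  (\forall x \ae cmeas mu, (f x <= C)%R) -> forall x, (f x <= C)%R.
Proof.
move=> [L0 fL] fC x; apply/ler_addgt0Pr => e e0.
have d0 : (0 < e / (L + 1))%R by rewrite divr_gt0// ltr_wpDl.
have [y xy fy] := ae_dense fC x d0; have := fL x y.
have : (L * mdist x y <= e)%R.
  apply: (@le_trans _ _ ((L + 1) * (e / (L + 1)))%R); last first.
    by rewrite mulrC divfK// gt_eqF// ltr_wpDl.
  by apply: ler_pM => //; [exact: mdist_ge0|rewrite lerDl|exact: ltW].
by rewrite ler_norml => ? /andP[_ ?]; lra.
Qed.

Lemma lipschitz_norm_sub f h L L' : is_lipschitz_constant f L ->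
  is_lipschitz_constant h L' ->
  is_lipschitz_constant (fun x => `|f x - h x|%R) (L + L').
Proof.
move=> [L0 fL] [L'0 hL']; split=> [|x y]; first exact: addr_ge0.
apply: (le_trans (ler_dist_dist _ _)).
rewrite (_ : f x - h x - (f y - h y) = (f x - f y) - (h x - h y))%R; last by lra.
by rewrite mulrDl; apply: (le_trans (ler_normB _ _)); exact: lerD.
Qed.

Lemma ae_eq_lipschitz f h L L' : is_lipschitz_constant f L ->
  is_lipschitz_constant h L' -> (\forall x \ae cmeas mu, f x = h x) -> f = h.
Proof.
move=> fL hL' fh; apply/funext => x; apply/eqP; rewrite -subr_eq0 -normr_eq0.
rewrite eq_le normr_ge0 andbT.
apply: (ae_lipschitz_le (lipschitz_norm_sub fL hL')).
by apply: filterS fh => y ->; rewrite subrr normr0.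
Qed.

(** McShane extension from the complement of a null set, which is dense. *)
Lemma ae_lipschitz_extension f L (M : R) P : (0 <= L)%R ->
  (\forall x \ae cmeas mu, P x) ->
  (forall x, P x -> (`|f x| <= M)%R) ->
  (forall x y, P x -> P y -> (`|f x - f y| <= L * mdist x y)%R) ->
  exists h, [/\ is_lipschitz_constant h L, exists C, forall x, (`|h x| <= C)%R &
    forall x, P x -> h x = f x].
Proof.
move=> L0 aeP fM fL.
pose S x := [set (f y + L * mdist x y)%R | y in [set y | P y]].
have M0 : (0 <= M)%R by have [y _ /fM] := ae_dense aeP point (ltr01 : (0 < 1 :> R)%R); exact: le_trans.
have lbS x : lbound (S x) (- M)%R.
  move=> _ [y Py <-]; have := fM y Py; rewrite ler_norml => /andP[? _].
  by have := mulr_ge0 L0 (mdist_ge0 x y); lra.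
have S0 x : S x !=set0.
  have [y _ Py] := ae_dense aeP x (ltr01 : (0 < 1 :> R)%R).
  by exists (f y + L * mdist x y)%R; exists y.
have hS x : has_lbound (S x) by exists (- M)%R.
exists (fun x => inf (S x)); split.
- split => // x y; wlog suff H : x y / (inf (S x) <= inf (S y) + L * mdist x y)%R.
    rewrite ler_distl; apply/andP; split; last exact: H.
    by rewrite lerBlDr metric_sym; exact: H.
  rewrite -lerBlDr; apply: lb_le_inf => // _ [z Pz <-].
  rewrite lerBlDr; apply: le_trans (ge_inf (hS x) _) _; first by exists z.
  by rewrite -addrA lerD2l -mulrDr ler_wpM2l// addrC metric_triangle.
- exists (M + L)%R => x; rewrite ler_norml; apply/andP; split.
    by apply: le_trans (lb_le_inf (S0 x) (lbS x)); rewrite lerN2 lerDl.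
  have [y xy Py] := ae_dense aeP x (ltr01 : (0 < 1 :> R)%R).
  apply: le_trans (ge_inf (hS x) _) _; first by exists y.
  apply: lerD; first by have := fM y Py; rewrite ler_norml => /andP[].
  by rewrite ler_piMr// ltW.
move=> x Px; apply/eqP; rewrite eq_le; apply/andP; split.
  apply: (ge_inf (hS x)); exists x => //; by rewrite mdistxx mulr0 addr0.
apply: lb_le_inf => // _ [y Py <-].
by have := fL x y Px Py; rewrite ler_norml => /andP[_ ?]; lra.
Qed.

End lipschitz_functions.

(** * Newtonian functions *)

Section newtonian.
Context (R : realType) (X : completeMetricType R).
Variable mu : {outer_measure set X -> \bar R}.
Hypothesis br : borel_regular mu.
Hypothesis mu_gt0 : 0 < mu [set: X].
Implicit Types (f g k : X -> \bar R).

Lemma Mod_oo_set0 : Mod_oo mu set0 = 0.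
Proof.
apply/eqP; rewrite eq_le; apply/andP; split.
  apply: ereal_inf_lbound; exists (cst 0); last exact: Linfty_norm_cst.
  by split => //; exact: measurable_cst.
by apply: le_ereal_inf_tmp => _ [rho _ <-]; exact: Linfty_norm_ge0.
Qed.

Lemma weak_upper_gradientW f g : borel_fun g -> (forall x, 0 <= g x) ->
  (forall c : curve X, rectifiable c -> nonconstant c -> ug_inequality f g c) ->
  weak_upper_gradient mu f g.
Proof.
move=> bg g0 H; split => //; exists set0; split => //; first exact: Mod_oo_set0.
by move=> c [[rc ncc] _]; exact: H.
Qed.

Lemma lipschitz_weak_upper_gradient (f : X -> R) (L : R) :
  is_lipschitz_constant f L -> weak_upper_gradient mu (EFin \o f) (cst L%:E).
Proof.
move=> [L0 fL]; apply: weak_upper_gradientW => // [|c rc _]; first exact: measurable_cst.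
rewrite /ug_inequality line_integral_cst// -EFinB abse_EFin.
apply: (@le_trans _ _ (L * mdist (c (cstart c)) (c (cend c)))%:E).
  by rewrite lee_fin.
rewrite EFinM; apply: lee_wpmul2l; first by rewrite lee_fin.
by apply: mdist_le_path_length; exact: cstart_le_cend.
Qed.

Lemma bounded_Linfty_norm (f : X -> R) (M : R) : (forall x, (`|f x| <= M)%R) ->
  Linfty_norm mu (EFin \o f) <= M%:E.
Proof.
by move=> fM; apply/Linfty_normP => //; apply: filterE => x; rewrite /= lee_fin.
Qed.

Lemma lipschitz_Linfty (f : X -> R) : LIPoo f -> Linfty mu (EFin \o f).
Proof.
move=> [[M fM] [L fL]]; split.
  by apply/measurable_EFinP; exact: (borel_fun_measurable br (lipschitz_borel fL)).
by apply: le_lt_trans (bounded_Linfty_norm fM) _; rewrite ltry.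
Qed.

Lemma lipschitz_Ntilde (f : X -> R) : LIPoo f -> Ntilde mu (EFin \o f).
Proof.
move=> Lf; have [_ [L fL]] := Lf; split; last 2 first.
- exact: lipschitz_Linfty.
- exists (cst L%:E); first exact: lipschitz_weak_upper_gradient.
  by split; [exact: measurable_cst|rewrite Linfty_norm_cst ?ltry//; case: fL].
exact: (@measurable_EFinP _ (g_sigma_algebraType (@open X)) _ _ _).2 (lipschitz_borel fL).
Qed.

Lemma Linfty_ae_fin f : Linfty mu f -> \forall x \ae cmeas mu, f x \is a fin_num.
Proof.
move=> [_ foo]; have := (Linfty_normP mu_gt0 f _).1 (lexx (Linfty_norm mu f)).
apply: filterS => x fx; rewrite fin_num_abs; exact: le_lt_trans foo.
Qed.

Let dist_sym (x z : \bar R) : z \is a fin_num -> `|x - z| = `|z - x|.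
Proof.
by case: x => [x| |]; case: z => [z| |]//= _; rewrite distrC.
Qed.

(** Two values that are both within a multiple of [y] of some common real number,
    for all small [y], are equal and finite. *)
Let close_limit (x1 x2 : \bar R) (G1 G2 l : R) : (0 < l)%R ->
  (0 <= G1)%R -> (0 <= G2)%R ->
  (forall y : R, (0 < y)%R -> (y <= l)%R ->
    exists z : R, `|x1 - z%:E| <= (G1 * y)%:E /\ `|x2 - z%:E| <= (G2 * y)%:E) ->
  x1 = x2 /\ x1 \is a fin_num.
Proof.
move=> l0 G10 G20; case: x1 => [x1| |]; case: x2 => [x2| |] H;
  try by have [z []] := H l l0 (lexx l).
split => //; congr EFin; apply/eqP; rewrite -subr_eq0 -normr_eq0 eq_le normr_ge0 andbT.
apply/ler_addgt0Pr => e e0; rewrite add0r.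
pose y := Num.min l (e / (G1 + G2 + 1))%R.
have G0 : (0 < G1 + G2 + 1)%R by rewrite ltr_wpDl// addr_ge0.
have y0 : (0 < y)%R by rewrite lt_min l0 divr_gt0.
have yl : (y <= l)%R by rewrite ge_min lexx.
have [z []] := H y y0 yl; rewrite -!EFinB !abse_EFin !lee_fin => h1 h2.
have : (y <= e / (G1 + G2 + 1))%R by rewrite ge_min lexx orbT.
rewrite ler_pdivlMr// => ye.
apply: (le_trans (ler_distD z _ _)); rewrite (distrC z).
by lra.
Qed.

(** Outside a null set two almost everywhere equal Newtonian functions agree
    and are finite; both are Lipschitz along curves meeting that set in zero
    length, so they also agree at the endpoints of such curves, which are limits
    of points of the curve outside the null set. *)
Lemma ae_eq_weak_upper_gradient0 k1 k2 : Ntilde mu k1 -> Ntilde mu k2 ->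
  (\forall x \ae cmeas mu, k1 x = k2 x) ->
  exists2 g, weak_upper_gradient mu (k1 \- k2) g & Linfty_norm mu g <= 0.
Proof.
move=> [_ Lk1 [g1 wg1 [_ g1oo]]] [_ Lk2 [g2 wg2 [_ g2oo]]] k12.
pose G1 := fine (Linfty_norm mu g1); pose G2 := fine (Linfty_norm mu g2).
have G10 : (0 <= G1)%R by rewrite fine_ge0// Linfty_norm_ge0.
have G20 : (0 <= G2)%R by rewrite fine_ge0// Linfty_norm_ge0.
have [N1 [bN1 N10 H1]] : exists N, [/\ borel_set N, mu N = 0 & forall c : curve X,
    rectifiable c -> nonconstant c -> null_length N c ->
    `|k1 (c (cstart c)) - k1 (c (cend c))| <= G1%:E * curve_length c].
  apply: (weak_upper_gradient_lipschitz br mu_gt0 wg1 G10).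
  by rewrite fineK// Linfty_fin_num.
have [N2 [bN2 N20 H2]] : exists N, [/\ borel_set N, mu N = 0 & forall c : curve X,
    rectifiable c -> nonconstant c -> null_length N c ->
    `|k2 (c (cstart c)) - k2 (c (cend c))| <= G2%:E * curve_length c].
  apply: (weak_upper_gradient_lipschitz br mu_gt0 wg2 G20).
  by rewrite fineK// Linfty_fin_num.
have aeN1 : \forall x \ae cmeas mu, ~ N1 x by exact: (borel_ae N10).
have aeN2 : \forall x \ae cmeas mu, ~ N2 x by exact: (borel_ae N20).
have [N [bN N0 HN]] : exists N, [/\ borel_set N, mu N = 0 & forall x, ~ N x ->
    [/\ ~ N1 x, ~ N2 x, k1 x = k2 x & k1 x \is a fin_num]].
  apply: (ae_borel br).
  have aeN12 : \forall x \ae cmeas mu, ~ N1 x /\ ~ N2 x by exact: filterS2 aeN1 aeN2.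
  by apply: filterS3 aeN12 k12 (Linfty_ae_fin Lk1) => x [].
have N1N : N1 `<=` N by move=> x N1x; apply: contrapT => /HN[].
have N2N : N2 `<=` N by move=> x N2x; apply: contrapT => /HN[].
exists (blow_up N 0); last exact: (Linfty_norm_blow_up mu_gt0 N0).
apply: weak_upper_gradientW => [|x|c rc ncc]; [exact: borel_blow_up|exact: blow_up_ge0|].
rewrite /ug_inequality.
have [Nc|nNc] := pselect (null_length N c); last first.
  by rewrite line_integral_blow_up// leey.
set l := fine (curve_length c); have l0 : (0 < l)%R := nonconstant_length rc ncc.
have ab := cstart_le_cend c.
have sub_bound s t (as_ : (cstart c <= s)%R) (st : (s <= t)%R) (tb : (t <= cend c)%R) :
    (arc_length c s < arc_length c t)%R ->
    `|k1 (c s) - k1 (c t)| <= (G1 * (arc_length c t - arc_length c s))%:E /\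
    `|k2 (c s) - k2 (c t)| <= (G2 * (arc_length c t - arc_length c s))%:E.
  move=> vst; have rc' := subcurve_rectifiable as_ st tb rc.
  have nc' : nonconstant (subcurve as_ st tb).
    by apply: length_nonconstant => //; rewrite subcurve_length// subr_gt0.
  have Nc' := null_length_subcurve as_ st tb rc Nc.
  rewrite !EFinM -(subcurve_length as_ st tb rc); split.
    exact: H1 rc' nc' (null_lengthS N1N Nc').
  exact: H2 rc' nc' (null_lengthS N2N Nc').
have va : arc_length c (cstart c) = 0%R := arc_length_start c.
have vb : arc_length c (cend c) = l by [].
have [eqa fina] : k1 (c (cstart c)) = k2 (c (cstart c)) /\
    k1 (c (cstart c)) \is a fin_num.
  apply: (close_limit l0 G10 G20) => y y0 yl.
  have [t /andP[at_ tb] [/andP[vt0 vty] Nt]] := null_length_arc rc Nc (lexx 0%R) y0 yl.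
  have [_ _ k12t kt] := HN _ Nt.
  have [|b1 b2] := sub_bound _ _ (lexx _) at_ tb; first by rewrite va.
  exists (fine (k1 (c t))); rewrite fineK//; split.
    apply: (le_trans b1); rewrite va subr0 lee_fin ler_wpM2l//; exact: ltW.
  by rewrite k12t; apply: (le_trans b2); rewrite va subr0 lee_fin ler_wpM2l// ltW.
have [eqb finb] : k1 (c (cend c)) = k2 (c (cend c)) /\
    k1 (c (cend c)) \is a fin_num.
  apply: (close_limit l0 G10 G20) => y y0 yl.
  have ly0 : (0 <= l - y)%R by rewrite subr_ge0.
  have lyl : (l - y < l)%R by rewrite ltrBlDr ltrDl.
  have [t /andP[at_ tb] [/andP[vt1 vt2] Nt]] := null_length_arc rc Nc ly0 lyl (lexx l).
  have [_ _ k12t kt] := HN _ Nt.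
  have [|b1 b2] := sub_bound _ _ at_ tb (lexx _); first by rewrite vb.
  have vty : (l - arc_length c t <= y)%R by lra.
  exists (fine (k1 (c t))); rewrite fineK//; split.
    by rewrite dist_sym//; apply: (le_trans b1); rewrite vb lee_fin ler_wpM2l.
  by rewrite k12t dist_sym -?k12t// k12t; apply: (le_trans b2); rewrite vb lee_fin ler_wpM2l.
rewrite /= -eqa -eqb !subee// abse0.
by apply: line_integral_ge0 => x; exact: blow_up_ge0.
Qed.

End newtonian.

(** * Consequences of the Poincare inequality *)

Section poincare.
Context (R : realType) (X : completeMetricType R).
Variable mu : {outer_measure set X -> \bar R}.
Hypothesis br : borel_regular mu.
Hypothesis mu_gt0 : 0 < mu [set: X].
Variable D : R.
Hypothesis D1 : (1 <= D)%R.
Hypothesis ball_pos : forall (x : X) (r : R), (0 < r)%R -> 0 < mu (ball x r) < +oo.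
Hypothesis mu_double : forall (x : X) (r : R), (0 < r)%R ->
  mu (ball x (2 * r)%R) <= D%:E * mu (ball x r).
Implicit Types (f g : X -> \bar R).
Local Notation nu := (cmeas mu).
Local Notation T := (caratheodory_type mu).

Definition truncation (M : R) f (x : X) : R :=
  fine (Order.max (- M)%:E (Order.min M%:E (f x))).

Lemma truncationE (M : R) f x : (0 <= M)%R ->
  (truncation M f x)%:E = Order.max (- M)%:E (Order.min M%:E (f x)).
Proof.
move=> M0; rewrite /truncation fineK//.
rewrite fin_real// lt_max ltNyr/= gt_max ltry/= gt_min ltry//.
Qed.

Lemma truncation_bound (M : R) f x : (0 <= M)%R -> (`|truncation M f x| <= M)%R.
Proof.
move=> M0; rewrite ler_norml -!lee_fin truncationE// le_max lexx/= ge_max ge_min lexx/=.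
by rewrite andbT lee_fin; lra.
Qed.

Lemma truncation_id (M : R) f x : `|f x| <= M%:E -> f x = (truncation M f x)%:E.
Proof.
move=> fM; have M0 : (0 <= M)%R by rewrite -lee_fin; exact: le_trans (abse_ge0 _) fM.
rewrite truncationE//; case: (f x) fM => [r| |]//.
rewrite lee_fin ler_norml => /andP[Mr rM].
by rewrite min_r ?lee_fin// max_r ?lee_fin.
Qed.

Lemma truncation_borel (M : R) f : borel_fun f -> borel_fun (truncation M f).
Proof.
move=> bf; apply: (@measurableT_comp _ _ _ (g_sigma_algebraType (@open X)) _ _ fine).
  exact: fine_measurable.
by apply: measurable_maxe => //; exact: measurable_mine.
Qed.

Lemma truncation_dist (M : R) f x y : (0 <= M)%R ->
  `|(truncation M f x)%:E - (truncation M f y)%:E| <= `|f x - f y|.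
Proof.
move=> M0; rewrite /truncation.
case: (f x) => [a| |]; case: (f y) => [b| |]; rewrite ?leey//.
rewrite -!EFin_min -!EFin_max/= lee_fin.
wlog ab : a b / (a <= b)%R.
  move=> H; have [|/ltW ba] := leP a b; first exact: H.
  by rewrite distrC (distrC a); exact: H.
rewrite [leRHS]ler0_norm ?subr_le0// ler_norml.
by case: (leP M a) => ?; case: (leP M b) => ?;
  repeat (case: (leP (- M)%R _) => ?); lra.
Qed.

(** Constant curves are harmless because [u] is real valued, and curves that spend
    positive length in [N] because the line integral is infinite on them. *)
Lemma blow_up_upper_gradient f (u : X -> R) N (G : R) : borel_set N -> (0 <= G)%R ->
  (forall x y, `|(u x)%:E - (u y)%:E| <= `|f x - f y|) ->
  (forall c : curve X, rectifiable c -> nonconstant c -> null_length N c ->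
    `|f (c (cstart c)) - f (c (cend c))| <= G%:E * curve_length c) ->
  upper_gradient (EFin \o u) (blow_up N G).
Proof.
move=> bN G0 uf H; split => [|x|c rc]; [exact: borel_blow_up|exact: blow_up_ge0|].
rewrite /ug_inequality.
have [ncc|cc] := pselect (nonconstant c); last first.
  rewrite /= (_ : c (cstart c) = c (cend c)).
    rewrite subrr normr0; apply: line_integral_ge0 => x; exact: blow_up_ge0.
  apply: contrapT => ab; apply: cc; exists (cstart c), (cend c).
  by rewrite !in_itv/= !lexx !cstart_le_cend.
have [Nc|nNc] := pselect (null_length N c); last first.
  by rewrite line_integral_blow_up// leey.
apply: le_trans (line_integral_blow_up_ge rc bN G0).
exact: le_trans (uf _ _) (H c rc ncc Nc).
Qed.

Lemma average_blow_up_power N (G p : R) x r : borel_set N -> mu N = 0 -> (0 <= G)%R ->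
  (1 <= p)%R -> (0 < r)%R ->
  average mu (ball x r) (fun y => blow_up N G y `^ p) `^ p^-1 = G%:E.
Proof.
move=> bN N0 G0 p1 r0; have p0 : (p != 0)%R by rewrite gt_eqF// (lt_le_trans _ p1).
have [b0 boo] := andP (ball_pos x r0).
have mball : measurable (ball x r : set T) := measurable_ball_cmeas br x r.
have -> : average mu (ball x r) (fun y => blow_up N G y `^ p) = G%:E `^ p.
  rewrite /average.
  have -> : \int[nu]_(y in ball x r) (blow_up N G y `^ p) =
      \int[nu]_(y in ball x r) (cst (G%:E `^ p) y).
    apply: ge0_ae_eq_integral => //.
    - apply: measurable_funS (measurableT) _ _ => //.
      apply: (measurableT_comp (measurable_poweR p)).
      exact: (borel_fun_measurable br (borel_blow_up G bN)).
    - by move=> y _; exact: poweR_ge0.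
    - by move=> y _; exact: poweR_ge0.
    apply: (borel_ae N0) => y Ny _.
    by rewrite /blow_up /patch memNset.
  rewrite integral_cst// -muleA divee ?mule1 ?gt_eqF//.
  exact: (ball_fin_num ball_pos).
by rewrite -poweRrM mulfV// poweRe1// lee_fin.
Qed.

(** The Poincare inequality is applied to the truncation of [f] at its essential
    bound, which is real valued and almost everywhere equal to [f].  Its upper
    gradient is [G] almost everywhere, so all its averages are [G]. *)
Lemma weak_poincare_lipschitz (p : R) : (1 <= p)%R -> weak_poincare mu p ->
  exists2 C : R, (0 <= C)%R & forall f g (G : R), borel_fun f -> Linfty mu f ->
    weak_upper_gradient mu f g -> (0 <= G)%R -> Linfty_norm mu g <= G%:E ->
    exists h : X -> R, [/\ is_lipschitz_constant h (C * G),
      exists B, forall x, (`|h x| <= B)%R & \forall x \ae nu, f x = (h x)%:E].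
Proof.
move=> p1 [C [la [C0 la1 poinc]]]; exists (8 * D ^+ 2 * C)%R.
  by rewrite !mulr_ge0// ?exprn_ge0// ltW// (lt_le_trans _ D1).
move=> f g G bf [mf foo] wg G0 gG.
have [N [bN N0 HN]] := weak_upper_gradient_lipschitz br mu_gt0 wg G0 gG.
pose M := fine (Linfty_norm mu f).
have M0 : (0 <= M)%R by rewrite fine_ge0// Linfty_norm_ge0.
pose u := truncation M f.
have bu : borel_fun u := truncation_borel M bf.
have fu : \forall x \ae nu, f x = (u x)%:E.
  have : Linfty_norm mu f <= M%:E by rewrite fineK// Linfty_fin_num.
  move=> /(Linfty_normP mu_gt0).
  by apply: filterS => x; exact: truncation_id.
have uug : upper_gradient (EFin \o u) (blow_up N G).
  by apply: blow_up_upper_gradient HN => // x y; exact: truncation_dist.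
have uM x : (`|u x| <= M)%R by exact: truncation_bound.
have [|x r r0|h [hL hB uh]] := @ae_lipschitz _ _ _ br _ D1 ball_pos mu_double u M
    (C * G)%R (borel_fun_measurable br bu) uM.
- by rewrite mulr_ge0// ltW.
- have := poinc u _ bu uug x r r0.
  rewrite average_blow_up_power//; last by rewrite mulr_gt0// (lt_le_trans _ la1).
  have [b0 boo] := andP (ball_pos x r0).
  rewrite {1}/average => H.
  rewrite -[leLHS]mule1 -(@mulVe _ (mu (ball x r))) ?gt_eqF ?(ball_fin_num ball_pos)// muleA.
  apply: lee_wpmul2r => //; apply: (le_trans H).
  by rewrite -EFinM lee_fin; lra.
exists h; split => //; first by rewrite -mulrA.
by apply: filterS2 fu uh => x -> ->.
Qed.

End poincare.

(** * The norm of bounded Lipschitz functions *)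

Section lipschitz_norm.
Context (R : realType) (X : completeMetricType R).
Variable f : X -> R.
Hypothesis Lf : LIPoo f.

Definition sup_norm : R := sup (range (fun x => `|f x|%R)).
Definition lip_constant : R := inf (is_lipschitz_constant f).

Lemma LIPoo_normE : LIPoo_norm f = (sup_norm + lip_constant)%:E.
Proof. by []. Qed.

Let hs : has_sup (range (fun x => `|f x|%R)).
Proof.
have [[M fM] _] := Lf; split; first by exists `|f point|%R, point.
by exists M => _ [x _ <-].
Qed.

Let hi : has_inf (is_lipschitz_constant f).
Proof.
have [_ [L fL]] := Lf; split; first by exists L.
by exists 0%R => L' [].
Qed.

Lemma le_sup_norm x : (`|f x| <= sup_norm)%R.
Proof. by apply: (ub_le_sup hs.2); exists x. Qed.

Lemma sup_norm_le C : (forall x, (`|f x| <= C)%R) -> (sup_norm <= C)%R.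
Proof. by move=> fC; apply: ge_sup; [exact: hs.1|move=> _ [x _ <-]]. Qed.

Lemma lip_constantP : is_lipschitz_constant f lip_constant.
Proof.
split; first by apply: lb_le_inf; [exact: hi.1|move=> L []].
move=> x y; have [->|xy] := eqVneq x y; first by rewrite subrr normr0 mdistxx mulr0.
have d0 : (0 < mdist x y)%R by rewrite mdist_gt0.
rewrite -ler_pdivrMr//; apply: lb_le_inf; first exact: hi.1.
by move=> L [_ fL]; rewrite ler_pdivrMr.
Qed.

Lemma lip_constant_le G : is_lipschitz_constant f G -> (lip_constant <= G)%R.
Proof. exact: (ge_inf hi.2). Qed.

Lemma sup_norm_ge0 : (0 <= sup_norm)%R.
Proof. exact: le_trans (le_sup_norm point). Qed.

Lemma LIPoo_norm_lower (C : R) (A B : \bar R) : (1 <= C)%R ->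
  sup_norm%:E <= A -> (C^-1 * lip_constant)%:E <= B ->
  (C^-1)%:E * LIPoo_norm f <= A + B.
Proof.
move=> C1 sA lB; rewrite LIPoo_normE -EFinM mulrDr EFinD; apply: leeD => //.
apply: le_trans sA; rewrite lee_fin ler_piMl// ?sup_norm_ge0//.
by rewrite invf_le1// (lt_le_trans _ C1).
Qed.

Lemma LIPoo_norm_upper (C : R) (A B N : \bar R) : (1 <= C)%R -> N <= A + B ->
  A <= sup_norm%:E -> B <= lip_constant%:E -> N <= C%:E * LIPoo_norm f.
Proof.
move=> C1 NAB As Bl; apply: (le_trans NAB); apply: (le_trans (leeD As Bl)).
rewrite LIPoo_normE -EFinD -EFinM lee_fin ler_peMl//.
by rewrite addr_ge0 ?sup_norm_ge0//; case: lip_constantP.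
Qed.

End lipschitz_norm.

Section spaces.
Context (R : realType) (X : completeMetricType R).
Variable mu : {outer_measure set X -> \bar R}.
Hypothesis br : borel_regular mu.
Hypothesis mu_gt0 : 0 < mu [set: X].
Hypothesis ball_pos : forall (x : X) (r : R), (0 < r)%R -> 0 < mu (ball x r) < +oo.
Local Notation nu := (cmeas mu).

Lemma sup_norm_le_Linfty (f : X -> R) (F : X -> \bar R) : LIPoo f ->
  (\forall x \ae nu, F x = (f x)%:E) -> Linfty mu F ->
  (sup_norm f)%:E <= Linfty_norm mu F.
Proof.
move=> Lf Ff [_ Foo]; have Ffin := Linfty_fin_num Foo.
rewrite -(fineK Ffin) lee_fin; apply: sup_norm_le => //.
have fL := lip_constantP Lf.
have c0 : is_lipschitz_constant (cst 0%R : X -> R) 0%R.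
  by split => // x y; rewrite subrr normr0 mul0r.
move=> x; have := ae_lipschitz_le ball_pos (lipschitz_norm_sub fL c0).
move=> /(_ (fine (Linfty_norm mu F)) _ x); rewrite subr0; apply.
have := (Linfty_normP mu_gt0 F _).1 (lexx _).
apply: filterS2 Ff => y -> /=; rewrite subr0.
by rewrite -{1}(fineK Ffin) lee_fin.
Qed.

Lemma Linfty_le_sup_norm (f : X -> R) : LIPoo f ->
  Linfty_norm mu (EFin \o f) <= (sup_norm f)%:E.
Proof. by move=> Lf; apply: bounded_Linfty_norm => // x; exact: le_sup_norm. Qed.

Lemma ae_eqP (f h : X -> R) :
  (f = h %[ae nu]) <-> (\forall x \ae nu, f x = h x).
Proof. by split; apply: filterS => x //; apply. Qed.

(** * Hajlasz gradients *)

Lemma lipschitz_hajlasz (f : X -> R) (L : R) : is_lipschitz_constant f L ->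
  hajlasz_gradient mu f (cst L).
Proof.
move=> [L0 fL]; split => //.
  split; first exact: (measurable_cst L%:E).
  rewrite [X in X < _](_ : _ = L%:E); first exact: ltry.
  exact: (Linfty_norm_cst mu_gt0 L0).
exists set0; first exact: outer_measure0.
move=> x y _ _; apply: (le_trans (fL x y)); rewrite mulrC ler_wpM2l ?mdist_ge0//=.
by rewrite lerDl.
Qed.

Lemma lipschitz_Mtilde (f : X -> R) : LIPoo f -> Mtilde mu f.
Proof.
move=> Lf; split; first exact: lipschitz_Linfty.
by exists (cst (lip_constant f)); apply: lipschitz_hajlasz; exact: lip_constantP.
Qed.

Lemma Linfty_ae_le (f : X -> R) : Linfty mu (EFin \o f) ->
  \forall x \ae nu, (`|f x| <= fine (Linfty_norm mu (EFin \o f)))%R.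
Proof.
move=> [_ foo]; have ffin := Linfty_fin_num foo.
apply: filterS ((Linfty_normP mu_gt0 (EFin \o f) _).1 (lexx _)) => x.
by rewrite -{1}(fineK ffin) /= lee_fin.
Qed.

(** The exceptional set of the gradient inequality is joined to the set where [g]
    exceeds its essential bound; the factor 2 comes from the two values of [g]. *)
Lemma hajlasz_null_set (f g : X -> R) : hajlasz_gradient mu f g ->
  exists2 P, (\forall x \ae nu, P x) & forall x y, P x -> P y ->
    (`|f x - f y| <= 2 * fine (Linfty_norm mu (EFin \o g)) * mdist x y)%R.
Proof.
move=> fg; have [goo g0 [E E0 HE]] := fg; have gG := Linfty_ae_le goo.
set G := fine _ in gG *.
exists (fun x => ~ E x /\ (`|g x| <= G)%R).
  by apply: filterS2 (borel_ae E0 (fun x => id)) gG.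
move=> x y [Ex gx] [Ey gy]; apply: (le_trans (HE x y Ex Ey)).
rewrite mulrC ler_wpM2r ?mdist_ge0// mulr_natl mulr2n lerD//.
  exact: le_trans (ler_norm _) gx.
exact: le_trans (ler_norm _) gy.
Qed.

Lemma MclassE (f h : X -> R) : LIPoo f -> LIPoo h -> Mclass mu f = Mclass mu h -> f = h.
Proof.
move=> Lf Lh fh; have [_ [L fL]] := Lf; have [_ [L' hL']] := Lh.
have : Mclass mu f h by rewrite fh; split; [exact: lipschitz_Mtilde|exact/ae_eqP/filterE].
by move=> [_ /ae_eqP]; exact: (ae_eq_lipschitz ball_pos fL hL').
Qed.

(** Surjectivity is the McShane extension of the restriction of the function to the
    complement of a null set. *)
Lemma Mclass_bij : set_bij (@LIPoo R X) (M1oo mu) (fun f => Mclass mu f).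
Proof.
split.
- by move=> f Lf; exists f => //; exact: lipschitz_Mtilde.
- by move=> f h /set_mem Lf /set_mem Lh; exact: MclassE.
move=> _ [f [Lf [g fg]] <-].
have [P aeP fP] := hajlasz_null_set fg.
have fM := Linfty_ae_le Lf.
have aeQ : \forall x \ae nu, P x /\ (`|f x| <= fine (Linfty_norm mu (EFin \o f)))%R.
  exact: filterS2 aeP fM.
set G := fine (Linfty_norm mu (EFin \o g)) in fP.
have G0 : (0 <= 2 * G)%R by rewrite mulr_ge0// fine_ge0// Linfty_norm_ge0.
have [h [hL hB hf]] := @ae_lipschitz_extension _ _ _ ball_pos f (2 * G)%R _ _ G0 aeQ
  (fun x Qx => Qx.2) (fun x y Qx Qy => fP x y Qx.1 Qy.1).
have hf' : \forall x \ae nu, h x = f x by apply: filterS aeQ => x /hf.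
exists h; first by split => //; exists (2 * G)%R.
apply/seteqP; split=> k [Mk /ae_eqP hk]; split => //; apply/ae_eqP.
  by apply: filterS2 hf' hk => x ->.
by apply: filterS2 hf' hk => x ->.
Qed.

Lemma M1oo_norm_equiv (f : X -> R) : LIPoo f ->
  (2^-1)%:E * LIPoo_norm f <= M1oo_norm mu (Mclass mu f) <= 2%:E * LIPoo_norm f.
Proof.
move=> Lf; have fL := lip_constantP Lf; apply/andP; split.
  apply: le_ereal_inf_tmp => _ [h [[Lh _] /ae_eqP fh] <-].
  apply: LIPoo_norm_lower => //; first by lra.
    by apply: sup_norm_le_Linfty => //; apply: filterS fh => x /= ->.
  apply: le_ereal_inf_tmp => _ [g hg <-].
  have [P aeP hP] := hajlasz_null_set hg.
  have [[_ goo] _ _] := hg; have gfin := Linfty_fin_num goo.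
  rewrite -[leRHS](fineK gfin) lee_fin ler_pdivrMl//.
  have aeQ : \forall x \ae nu, P x /\ f x = h x by exact: filterS2 aeP fh.
  apply: lip_constant_le => //; apply: (ae_lipschitz_constant ball_pos fL _ aeQ).
    by rewrite mulr_ge0// fine_ge0// Linfty_norm_ge0.
  by move=> x y [Px ->] [Py ->]; exact: hP.
apply: (@LIPoo_norm_upper _ _ _ Lf 2 (Linfty_norm mu (EFin \o f))
  (ereal_inf [set Linfty_norm mu (EFin \o g) | g in hajlasz_gradient mu f])).
- by lra.
- apply: ereal_inf_lbound; exists f => //; split; first exact: lipschitz_Mtilde.
  exact/ae_eqP/filterE.
- exact: Linfty_le_sup_norm.
apply: ereal_inf_lbound; exists (cst (lip_constant f)); first exact: lipschitz_hajlasz.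
by apply: Linfty_norm_cst => //; case: fL.
Qed.

(** * Classes of Newtonian functions *)

(** The difference of two almost everywhere equal Newtonian functions has a weak
    upper gradient of essential norm zero, so the classes are those of almost
    everywhere equality. *)
Lemma NclassP (f h : X -> \bar R) : Ntilde mu f ->
  Nclass mu f h <-> Ntilde mu h /\ (\forall x \ae nu, f x = h x).
Proof.
move=> Nf; split=> -[Nh fh]; split => //.
  have : Linfty_norm mu (f \- h) <= 0.
    rewrite -fh leeDl//; apply: le_ereal_inf_tmp => _ [g _ <-].
    exact: Linfty_norm_ge0.
  move=> /(Linfty_normP mu_gt0); apply: filterS => x.
  by case: (f x) (h x) => [a| |] [b| |]//=; rewrite lee_fin normr_le0 subr_eq0 => /eqP ->.
have [g wg g0] := ae_eq_weak_upper_gradient0 br mu_gt0 Nf Nh fh.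
apply/eqP; rewrite eq_le; apply/andP; split; last first.
  rewrite adde_ge0 ?Linfty_norm_ge0//; apply: le_ereal_inf_tmp => _ [k _ <-].
  exact: Linfty_norm_ge0.
rewrite -[leRHS]adde0; apply: leeD.
  have [_ Lf _] := Nf; apply/(Linfty_normP mu_gt0).
  by apply: filterS2 fh (Linfty_ae_fin mu_gt0 Lf) => x <- ffin; rewrite subee// abse0.
by apply: le_trans g0; apply: ereal_inf_lbound; exists g.
Qed.

Lemma N1oo_norm_upper (C : R) (f : X -> R) : (1 <= C)%R -> LIPoo f ->
  N1oo_norm mu (Nclass mu (EFin \o f)) <= C%:E * LIPoo_norm f.
Proof.
move=> C1 Lf; have fL := lip_constantP Lf.
apply: (@LIPoo_norm_upper _ _ _ Lf C (Linfty_norm mu (EFin \o f))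
  (ereal_inf [set Linfty_norm mu g | g in weak_upper_gradient mu (EFin \o f)])) => //.
- have Nf := lipschitz_Ntilde br mu_gt0 Lf.
  apply: ereal_inf_lbound; exists (EFin \o f) => //.
  by apply/NclassP => //; split => //; exact: filterE.
- exact: Linfty_le_sup_norm.
apply: ereal_inf_lbound; exists (cst (lip_constant f)%:E).
  exact: lipschitz_weak_upper_gradient.
by apply: Linfty_norm_cst => //; case: fL.
Qed.

End spaces.

Theorem corollary5p16 (R : realType) (X : completeMetricType R)
    (mu : {outer_measure set X -> \bar R}) (p : R)
    (mu_borel_regular : borel_regular mu)
    (mu_nontrivial : 0 < mu [set: X])
    (mu_finite_on_balls : forall (x : X) (r : R), mu (ball x r) < +oo)
    (mu_doubling : doubling mu)
    (p_ge1 : (1 <= p)%R)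
    (poincare : weak_poincare mu p) :
  [/\ set_bij (@LIPoo R X) (M1oo mu) (fun f => Mclass mu f),
      set_bij (@LIPoo R X) (N1oo mu) (fun f => Nclass mu (EFin \o f)),
      exists2 C : R, (0 < C)%R & forall f : X -> R, LIPoo f ->
        (C^-1)%:E * LIPoo_norm f <= M1oo_norm mu (Mclass mu f) <=
        C%:E * LIPoo_norm f &
      exists2 C : R, (0 < C)%R & forall f : X -> R, LIPoo f ->
        (C^-1)%:E * LIPoo_norm f <= N1oo_norm mu (Nclass mu (EFin \o f)) <=
        C%:E * LIPoo_norm f].
Proof.
have [C0 C00 dbl] := mu_doubling; pose D := Num.max 1%R C0.
have D1 : (1 <= D)%R by rewrite le_max lexx.
have ball_pos (x : X) (r : R) : (0 < r)%R -> 0 < mu (ball x r) < +oo.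
  move=> r0; rewrite mu_finite_on_balls andbT.
  have r20 : (0 < r / 2)%R by rewrite divr_gt0.
  by have [+ _ _] := dbl x _ r20; rewrite mulrC divfK.
have mu_double (x : X) (r : R) : (0 < r)%R ->
    mu (ball x (2 * r)%R) <= D%:E * mu (ball x r).
  move=> r0; have [_ h _] := dbl x _ r0; apply: (le_trans h).
  by apply: lee_wpmul2r; [exact: outer_measure_ge0|rewrite lee_fin le_max lexx orbT].
have [C C_ge0 HC] := weak_poincare_lipschitz mu_borel_regular mu_nontrivial D1
  ball_pos mu_double p_ge1 poincare.
have NP := NclassP mu_borel_regular mu_nontrivial.
have lipN (f : X -> R) (Lf : LIPoo f) := lipschitz_Ntilde mu_borel_regular mu_nontrivial Lf.
split.
- exact: Mclass_bij.
- split.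
  + by move=> f Lf; exists (EFin \o f) => //; exact: lipN.
  + move=> f h /set_mem Lf /set_mem Lh fh.
    have [_ [L fL]] := Lf; have [_ [L' hL']] := Lh.
    have : Nclass mu (EFin \o f) (EFin \o h).
      by rewrite fh; apply/NP; [exact: lipN|split; [exact: lipN|exact: filterE]].
    move=> /(NP _ _ (lipN f Lf))[_ fh'].
    apply: (ae_eq_lipschitz ball_pos fL hL').
    by apply: filterS fh' => x [].
  (* The class of [f] is that of the Lipschitz function almost everywhere equal to
     [f]. *)
  move=> _ [f Nf <-]; have [bf Lf [g wg [_ goo]]] := Nf.
  have gfin := Linfty_fin_num goo.
  have [||h [hL hB fh]] := HC f g (fine (Linfty_norm mu g)) bf Lf wg.
  + by rewrite fine_ge0// Linfty_norm_ge0.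
  + by rewrite fineK.
  have Lh : LIPoo h by split => //; exists (C * fine (Linfty_norm mu g))%R.
  exists h => //; apply/seteqP; split=> k.
    move=> /(NP _ _ (lipN h Lh))[Nk hk]; apply/NP => //; split => //.
    by apply: filterS2 fh hk => x ->.
  move=> /(NP _ _ Nf)[Nk fk]; apply/NP; [exact: lipN|split => //].
  by apply: filterS2 fh fk => x /= <-.
- by exists 2%R => // f; exact: M1oo_norm_equiv.
pose C' := Num.max 1%R C.
have C'1 : (1 <= C')%R by rewrite le_max lexx.
have C'0 : (0 < C')%R by rewrite (lt_le_trans _ C'1).
exists C' => // f Lf; rewrite N1oo_norm_upper// andbT.
have fL := lip_constantP Lf.
apply: le_ereal_inf_tmp => _ [F /(NP _ _ (lipN f Lf))[[bF LF _] fF] <-].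
apply: LIPoo_norm_lower => //.
  by apply: sup_norm_le_Linfty => //; apply: filterS fF => x <-.
apply: le_ereal_inf_tmp => _ [g wg <-].
have [->|] := eqVneq (Linfty_norm mu g) +oo; first by rewrite leey.
rewrite -ltey => goo; have gfin := Linfty_fin_num goo.
have G0 : (0 <= fine (Linfty_norm mu g))%R by rewrite fine_ge0// Linfty_norm_ge0.
have [|h [hL _ Fh]] := HC F g _ bF LF wg G0; first by rewrite fineK.
have fh : f = h.
  by apply: (ae_eq_lipschitz ball_pos fL hL); apply: filterS2 fF Fh => x <- [].
rewrite -[leRHS](fineK gfin) lee_fin ler_pdivrMl//.
apply: (@le_trans _ _ (C * fine (Linfty_norm mu g))%R).
  by apply: lip_constant_le => //; rewrite fh.
by rewrite ler_wpM2r// le_max lexx orbT.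
Qed.
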